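(* Let $f\in D(-L)$ (so that $f$ vanishes on $\partial\Omega$, compatibly with the lateral boundary condition at $x=0$) and $g\in L^2(\Omega)$. Then the solution $u(x,y)$ of the boundary value problem $$\begin{cases} D_x^{2\alpha}u(x,y)+Lu(x,y)=g(y), & (x,y)\in(0,\infty)\times\Omega,\\ u(x,y)=0, & (x,y)\in(0,\infty)\times\partial\Omega,\\ u(0,y)=f(y), & y\in\Omega,\\ \lim_{x\to\infty}\|u(x,\cdot)\|_{L^2(\Omega)}<\infty & \end{cases}$$ satisfies $$\|u(x,\cdot)\|_{L^2(\Omega)}\le\|f\|_{L^2(\Omega)}+\eta_4\|g\|_{L^2(\Omega)}\quad\text{for all }x>0,$$ $$\sup_{x\in(0,\infty)}\|D_x^{2\alpha}u(x,\cdot)\|_{L^2(\Omega)}\le\|f\|_{D(-L)}+\left(1+\frac{\eta_2}{\eta_3}\right)\|g\|_{L^2(\Omega)},$$ $$\sup_{x\in(0,\infty)}\|Lu(x,\cdot)\|_{L^2(\Omega)}\le\|f\|_{D(-L)}+\frac{\eta_2}{\eta_3}\|g\|_{L^2(\Omega)},$$ where $\eta_2=\frac{\Gamma(1+\beta)}{\Gamma(1+\alpha+\beta)}$, $\eta_3=\frac{\Gamma(1+\alpha+2\beta)}{\Gamma(1+2\alpha+2\beta)}$ and $\eta_4=\frac{\eta_2}{\eta_3\lambda_1}$, with $\lambda_1>0$ the first eigenvalue of $-L$.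
   Context: Let $\alpha\in(0,1]$, $\beta\ge 0$, and let $\Omega\subset\mathbb{R}^N$ ($N\ge1$) be a bounded connected domain with smooth boundary $\partial\Omega$. $(\cdot,\cdot)$ is the inner product of $L^2(\Omega)$. $-L:H^2(\Omega)\cap H_0^1(\Omega)\to L^2(\Omega)$ is a symmetric uniformly elliptic operator with eigenpairs $-L\varphi_k=\lambda_k\varphi_k$, $0<\lambda_1\le\lambda_2\le\cdots\to\infty$, where $\{\varphi_k\}_{k\ge1}$ is a complete orthonormal basis of $L^2(\Omega)$. $D(-L)=\{\psi\in L^2(\Omega):\sum_k\lambda_k^2|(\psi,\varphi_k)|^2<\infty\}$ with norm $\|\psi\|_{D(-L)}=(\sum_k\lambda_k^2|(\psi,\varphi_k)|^2)^{1/2}$. Caputo derivative in $x$: $\partial_{0,x}^\alpha v(x)=\frac{1}{\Gamma(1-\alpha)}\int_0^x(x-s)^{-\alpha}v'(s)\,ds$ for $\alpha\in(0,1)$, and $\partial_{0,x}^1v=v'$. Set $D_x^\alpha=\frac{1}{x^\beta}\partial_{0,x}^\alpha$ and $D_x^{2\alpha}=D_x^\alpha D_x^\alpha$. The operators $D_x^{2\alpha}$ and $L$ act on $u=\sum_k u_k(x)\varphi_k(y)$ term by term: $D_x^{2\alpha}u=\sum_k(D_x^{2\alpha}u_k)\varphi_k$, $Lu=-\sum_k\lambda_ku_k\varphi_k$. Three-parameter Mittag-Leffler (Kilbas–Saigo) function, for $\alpha,m>0$, $n>-1/\alpha$: $E_{\alpha,m,n}(z)=1+\sum_{k=1}^\infty\prod_{j=0}^{k-1}\frac{\Gamma(\alpha(jm+n)+1)}{\Gamma(\alpha(jm+n+1)+1)}z^k$.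 The (unique generalized) solution of the boundary value problem is, with $f_k=(f,\varphi_k)$, $g_k=(g,\varphi_k)$, $$u(x,y)=\sum_{k=1}^{\infty} f_k\,E_{\alpha,1+\frac{\beta}{\alpha},\frac{\beta}{\alpha}}\left(-\sqrt{\lambda_k}\,x^{\alpha+\beta}\right)\varphi_k(y)-\sum_{k=1}^{\infty}\eta_2\frac{g_k}{\sqrt{\lambda_k}}\,x^{\alpha+\beta}E_{\alpha,1+\frac{\beta}{\alpha},1+\frac{2\beta}{\alpha}}\left(-\sqrt{\lambda_k}\,x^{\alpha+\beta}\right)\varphi_k(y).$$ *)

(* Defs.v *)
From HB Require Import structures.
From mathcomp Require Import all_boot all_order all_algebra.
From mathcomp Require Import all_classical all_reals all_analysis.

Set Implicit Arguments.
Unset Strict Implicit.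
Unset Printing Implicit Defensive.
Import Order.TTheory GRing.Theory Num.Theory.
Import numFieldNormedType.Exports.
Local Open Scope classical_set_scope.
Local Open Scope ring_scope.

Definition rV_display : measure_display.
Proof. exact: (measure_tuple_display default_measure_display). Qed.

Section rV_measurable.
Context (R : realType) (n : nat).

Definition rV_coord (i : 'I_n) (x : 'rV[R]_n) : measurableTypeR R := x ord0 i.

Let rV_set0 : g_sigma_preimage rV_coord set0.
Proof. exact: sigma_algebra0. Qed.

Let rV_setC A : g_sigma_preimage rV_coord A -> g_sigma_preimage rV_coord (~` A).
Proof. exact: sigma_algebraC. Qed.

Let rV_bigcup (F : (set 'rV[R]_n)^nat) :
  (forall i, g_sigma_preimage rV_coord (F i)) ->
  g_sigma_preimage rV_coord (\bigcup_i (F i)).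
Proof. exact: sigma_algebra_bigcup. Qed.

(* The product (Borel) sigma-algebra, generated by the coordinate maps. *)
HB.instance Definition _ := @isMeasurable.Build rV_display 'rV[R]_n
  (g_sigma_preimage rV_coord) rV_set0 rV_setC rV_bigcup.

Lemma measurable_rV_coord i : measurable_fun [set: 'rV[R]_n] (rV_coord i).
Proof.
move=> _ Y mY; rewrite setTI; apply: sub_sigma_algebra => /=.
rewrite -bigcup_seq/=; exists i => /=; first by rewrite mem_index_enum.
by exists Y => //; rewrite setTI.
Qed.

Lemma measurable_fun_rV d (T : measurableType d) (f : T -> 'rV[R]_n) :
  (forall i, measurable_fun [set: T] (rV_coord i \o f)) ->
  measurable_fun [set: T] f.
Proof.
move=> mf.
have sub : g_sigma_preimage (fun i => rV_coord i \o f) `<=` measurable.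
  apply: smallest_sub; first exact: sigma_algebra_measurable.
  rewrite -bigcup_seq => A [i _ [B mB <-]]; exact: mf.
rewrite g_sigma_preimage_comp in sub => _ A mA; apply: sub.
by exists A.
Qed.

End rV_measurable.

Section lebesgue_step.
Context (R : realType) (n : nat) (m : {sigma_finite_measure set 'rV[R]_n -> \bar R}).

Definition rV_cons (p : measurableTypeR R * 'rV[R]_n) : 'rV[R]_n.+1 :=
  \row_i (if unlift ord0 i is Some j then p.2 ord0 j else p.1).

Definition rV_uncons (x : 'rV[R]_n.+1) : measurableTypeR R * 'rV[R]_n :=
  (x ord0 ord0, \row_j x ord0 (lift ord0 j)).

Lemma rV_consK : cancel rV_cons rV_uncons.
Proof.
move=> [t y]; rewrite /rV_uncons /rV_cons !mxE unlift_none /=; congr pair.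
by apply/rowP => j; rewrite !mxE liftK.
Qed.

Lemma measurable_rV_cons : measurable_fun setT rV_cons.
Proof.
apply: measurable_fun_rV => i; case: (unliftP ord0 i) => [j ij|i0].
  rewrite (_ : _ \o _ = rV_coord j \o snd); last first.
    by apply/funext => p /=; rewrite /rV_coord mxE ij liftK.
  exact: measurableT_comp (measurable_rV_coord j) measurable_snd.
rewrite (_ : _ \o _ = fst); first exact: measurable_fst.
by apply/funext => p /=; rewrite /rV_coord mxE i0 unlift_none.
Qed.

#[local] Hint Resolve measurable_rV_cons : core.

Lemma measurable_rV_uncons : measurable_fun setT rV_uncons.
Proof.
apply/measurable_fun_pairP; split; first exact: measurable_rV_coord.
apply: measurable_fun_rV => i.
rewrite (_ : _ \o _ = rV_coord (lift ord0 i)); first exact: measurable_rV_coord.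
by apply/funext => x /=; rewrite /rV_coord mxE.
Qed.

Definition lebesgue_step : set 'rV[R]_n.+1 -> \bar R :=
  pushforward (lebesgue_measure \x m)%E rV_cons.

Let step0 : lebesgue_step set0 = 0%E.
Proof. by rewrite /lebesgue_step /pushforward preimage_set0 measure0. Qed.

Let step_ge0 A : (0 <= lebesgue_step A)%E.
Proof. exact: measure_ge0. Qed.

Let step_sigma_additive : semi_sigma_additive lebesgue_step.
Proof.
exact: measure_semi_sigma_additive.
Qed.

HB.instance Definition _ := isMeasure.Build _ _ _ lebesgue_step
  step0 step_ge0 step_sigma_additive.

Let step_sigma_finite : sigma_finite setT lebesgue_step.
Proof.
have [F TF Foo] : sigma_finite setT (lebesgue_measure \x m)%E.
  have /sigma_finiteP[F [TF ndF Foo]] := sigma_finiteT (@lebesgue_measure R).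
  have /sigma_finiteP[G [TG ndG Goo]] := sigma_finiteT m.
  exists (fun k => F k `*` G k).
    rewrite -setXTT TF TG predeqE => -[x y]; split; last first.
      by move=> [k _ []/= ? ?]; split; exists k.
    move=> [/= [k _ Fkx] [l _ Gly]]; exists (maxn k l) => //; split.
    - by move: x Fkx; exact/subsetPset/ndF/leq_maxl.
    - by move: y Gly; exact/subsetPset/ndG/leq_maxr.
  move=> k; have [? ?] := Foo k; have [? ?] := Goo k.
  split; first exact: measurableX.
  by rewrite product_measure1E// lte_mul_pinfty// ge0_fin_numE.
exists (fun k => rV_uncons @^-1` F k).
  by rewrite -preimage_bigcup -TF preimage_setT.
move=> k; have [mF Fk] := Foo k; split.
  by rewrite -[X in measurable X]setTI; exact: measurable_rV_uncons.
rewrite /lebesgue_step /pushforward -comp_preimage.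
rewrite (_ : _ \o _ = id) ?preimage_id//.
by apply/funext => p; exact: rV_consK.
Qed.

HB.instance Definition _ := Measure_isSigmaFinite.Build _ _ _ lebesgue_step
  step_sigma_finite.

End lebesgue_step.

(* Lebesgue measure on R^n.+1 is the product of Lebesgue measures on R and R^n,
   transported along (t, y) |-> (t, y_1, ..., y_n). *)
Fixpoint lebesgue_rV (R : realType) (n : nat) :
    {sigma_finite_measure set 'rV[R]_n -> \bar R} :=
  if n is n'.+1 then lebesgue_step (lebesgue_rV R n')
  else @dirac _ 'rV[R]_0 (0 : 'rV[R]_0) R.

Section L2.
Context (R : realType) (N : nat) (Omega : set 'rV[R]_N).
Local Notation E := 'rV[R]_N.
Local Notation mu := (lebesgue_rV R N).
Implicit Types (f g h : E -> R) (e : nat -> E -> R) (c : nat -> R).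

(* Functions on Omega are total functions on R^N whose values outside Omega
   are irrelevant: only the extension by zero [f \_ Omega] is ever used. *)
Definition L2 f : Prop := f \_ Omega \in Lfun mu 2%:E.

Definition L2norm f : \bar R := 'N[mu]_2%:E[EFin \o (f \_ Omega)]%E.

Definition L2dot f g : R := \int[mu]_(y in Omega) (f y * g y).

Definition L2cvg (F : nat -> E -> R) h : Prop :=
  (fun n => L2norm (fun y => F n y - h y)) @ \oo --> (0 : \bar R).

Definition L2series e c h : Prop :=
  L2 h /\ L2cvg (fun n y => \sum_(0 <= k < n) c k * e k y) h.

Definition orthonormal_basis e : Prop :=
  [/\ forall k, L2 (e k),
      forall j k, L2dot (e j) (e k) = (j == k)%:R
    & forall f, L2 f -> L2series e (fun k => L2dot f (e k)) f].

End L2.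

Section smooth.
Context (R : realType) (N : nat).
Local Notation E := 'rV[R]_N.

Definition partial (i : 'I_N) (f : E -> R) : E -> R :=
  fun x => 'D_(delta_mx ord0 i) f x.

Definition smooth (f : E -> R) : Prop := forall s : seq 'I_N,
  let fs := foldr partial f s in
  continuous fs /\ forall i x, derivable fs x (delta_mx ord0 i).

(* Near each boundary point Omega is the sublevel set {rho < 0} of a smooth
   function rho with nonvanishing gradient at that point. *)
Definition smooth_boundary (Omega : set E) : Prop :=
  forall p, (closure Omega `\` interior Omega) p ->
  exists rho : E -> R, [/\ smooth rho,
    exists i, partial i rho p != 0
    & \forall x \near p, Omega x <-> rho x < 0].

Definition smooth_bounded_domain (Omega : set E) : Prop :=
  [/\ open Omega, connected Omega, Omega !=set0, bounded_set Omega
    & smooth_boundary Omega].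

End smooth.

Section sobolev.
Context (R : realType) (N : nat) (Omega : set 'rV[R]_N).
Local Notation E := 'rV[R]_N.
Local Notation mu := (lebesgue_rV R N).

Definition test_function (psi : E -> R) : Prop :=
  smooth psi /\ exists K : set E,
    [/\ compact K, K `<=` Omega & forall x, ~ K x -> psi x = 0].

(* Weak derivatives are unique only almost everywhere, so the Sobolev spaces
   are relations between v and its weak derivatives dv, d2v. *)
Definition weak_partial (i : 'I_N) (v w : E -> R) : Prop :=
  [/\ L2 Omega v, L2 Omega w
    & forall psi, test_function psi ->
        L2dot Omega v (partial i psi) = - L2dot Omega w psi].

Definition H1 (v : E -> R) (dv : 'I_N -> E -> R) : Prop :=
  L2 Omega v /\ forall i, weak_partial i v (dv i).

Definition H2 (v : E -> R) (dv : 'I_N -> E -> R) (d2v : 'I_N -> 'I_N -> E -> R) :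
    Prop :=
  H1 v dv /\ forall i j, weak_partial j (dv i) (d2v i j).

(* H^1_0(Omega) is the closure of the test functions in H^1(Omega). *)
Definition H10 (v : E -> R) : Prop :=
  exists (dv : 'I_N -> E -> R) (psi : nat -> E -> R),
    [/\ H1 v dv, forall n, test_function (psi n), L2cvg Omega psi v
      & forall i, L2cvg Omega (fun n => partial i (psi n)) (dv i)].

Definition bounded_coef (a : E -> R) : Prop :=
  measurable_fun setT (a \_ Omega) /\
  exists M : R, forall y, Omega y -> `|a y| <= M.

(* The coefficients of a second-order operator
   L v = \sum_(i, j) a_ij d_i d_j v + \sum_i b_i d_i v + c v. *)
Record coefficients := Coefficients {
  top_coef : 'I_N -> 'I_N -> E -> R ;
  drift_coef : 'I_N -> E -> R ;
  zero_coef : E -> R }.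

(* v belongs to D(L), the intersection of H^2(Omega) and H^1_0(Omega), and
   w = L v almost everywhere in Omega. *)
Definition operator (L : coefficients) (v w : E -> R) : Prop :=
  [/\ H10 v, L2 Omega w
    & exists dv d2v, H2 v dv d2v /\
        {ae mu, forall y, Omega y ->
           w y = \sum_i \sum_j top_coef L i j y * d2v i j y
                 + \sum_i drift_coef L i y * dv i y + zero_coef L y * v y}].

Definition uniformly_elliptic (L : coefficients) : Prop :=
  [/\ (forall i j, bounded_coef (top_coef L i j)) /\
      (forall i j y, Omega y -> top_coef L i j y = top_coef L j i y),
      forall i, bounded_coef (drift_coef L i), bounded_coef (zero_coef L)
    & exists2 theta : R, 0 < theta & forall y (xi : E), Omega y ->
        theta * (\sum_i xi ord0 i ^+ 2) <=
        \sum_i \sum_j top_coef L i j y * xi ord0 i * xi ord0 j].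

Definition symmetric_operator (L : coefficients) : Prop :=
  forall v Lv w Lw, operator L v Lv -> operator L w Lw ->
    L2dot Omega Lv w = L2dot Omega v Lw.

(* The eigenpairs (lam_k, phi_k) of -L, indexed from 0: the first eigenvalue
   is [lam 0]. *)
Definition eigenbasis (L : coefficients) (lam : nat -> R) (phi : nat -> E -> R) :
    Prop :=
  [/\ orthonormal_basis Omega phi,
      forall k, operator L (phi k) (fun y => - (lam k * phi k y)),
      0 < lam 0%N, forall k, lam k <= lam k.+1
    & lam @ \oo --> +oo].

End sobolev.

Section fractional.
Context (R : realType).
Local Notation leb := (@lebesgue_measure R).
Implicit Types (alpha beta m n s x z : R) (v : R -> R).

Definition Gamma s : R :=
  \int[leb]_(t in `]0, +oo[) (t `^ (s - 1) * expR (- t)).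

(* Caputo derivative of order alpha \in ]0, 1] based at 0, for x > 0. *)
Definition caputo alpha v x : R :=
  if alpha == 1 then derive1 v x
  else (Gamma (1 - alpha))^-1 *
       \int[leb]_(s in `]0, x[) ((x - s) `^ (- alpha) * derive1 v s).

Definition Dx alpha beta v : R -> R :=
  fun x => (x `^ beta)^-1 * caputo alpha v x.

Definition D2x alpha beta v : R -> R := Dx alpha beta (Dx alpha beta v).

(* The empty product for k = 0 gives the leading term 1 of the series. *)
Definition kilbas_saigo_coef alpha m n (k : nat) : R :=
  \prod_(0 <= j < k) (Gamma (alpha * (j%:R * m + n) + 1) /
                      Gamma (alpha * (j%:R * m + n + 1) + 1)).

Definition kilbas_saigo alpha m n z : R :=
  limn (series (fun k => kilbas_saigo_coef alpha m n k * z ^+ k)).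

Definition eta2 alpha beta : R := Gamma (1 + beta) / Gamma (1 + alpha + beta).

Definition eta3 alpha beta : R :=
  Gamma (1 + alpha + 2 * beta) / Gamma (1 + 2 * alpha + 2 * beta).

Definition eta4 alpha beta lam1 : R :=
  eta2 alpha beta / (eta3 alpha beta * lam1).

End fractional.

Section problem.
Context (R : realType) (N : nat) (Omega : set 'rV[R]_N).
Local Notation E := 'rV[R]_N.
Local Notation mu := (lebesgue_rV R N).
Context (lam : nat -> R) (phi : nat -> E -> R) (alpha beta : R).
Implicit Types (f g : E -> R) (u w : R -> E -> R).

Definition DLnorm f : \bar R :=
  ((\sum_(0 <= k <oo) ((lam k) ^+ 2 * `|L2dot Omega f (phi k)| ^+ 2)%:E)
     `^ 2^-1)%E.

Definition DL f : Prop := L2 Omega f /\ (DLnorm f < +oo)%E.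

Definition solution_coef f g (k : nat) (x : R) : R :=
  L2dot Omega f (phi k) *
    kilbas_saigo alpha (1 + beta / alpha) (beta / alpha)
      (- Num.sqrt (lam k) * x `^ (alpha + beta))
  - eta2 alpha beta * (L2dot Omega g (phi k) / Num.sqrt (lam k)) *
    x `^ (alpha + beta) *
    kilbas_saigo alpha (1 + beta / alpha) (1 + 2 * beta / alpha)
      (- Num.sqrt (lam k) * x `^ (alpha + beta)).

(* u is the generalized solution: u(x, .) is the sum in L^2(Omega) of the
   eigenfunction series of the problem. *)
Definition generalized_solution f g u : Prop :=
  forall x, 0 <= x ->
    L2series Omega phi (fun k => solution_coef f g k x) (u x).

(* w = D_x^{2 alpha} u, where D_x^{2 alpha} acts term by term on
   u(x, .) = \sum_k u_k(x) phi_k, u_k(x) = (u(x, .), phi_k). *)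
Definition applies_D2x u w : Prop :=
  forall x, 0 < x -> L2series Omega phi
    (fun k => D2x alpha beta (fun s => L2dot Omega (u s) (phi k)) x) (w x).

Definition applies_L u w : Prop :=
  forall x, 0 < x -> L2series Omega phi
    (fun k => - (lam k * L2dot Omega (u x) (phi k))) (w x).

(* D2u and Lu stand for D_x^{2 alpha} u and L u. The lateral condition
   u(x, .) = 0 on the boundary of Omega is expressed by u(x, .) \in D(-L). *)
Definition solves_bvp f g u D2u Lu : Prop :=
  [/\ applies_D2x u D2u /\ applies_L u Lu,
      forall x, 0 < x ->
        {ae mu, forall y, Omega y -> D2u x y + Lu x y = g y},
      forall x, 0 < x -> DL (u x),
      {ae mu, forall y, Omega y -> u 0 y = f y}
    & exists l : R, L2norm Omega (u x) @[x --> +oo] --> l%:E].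

End problem.

(* Main.v *)
(* Put gam = alpha + beta and v_mu(x) = E_{alpha, 1 + beta/alpha, beta/alpha}(- mu x^gam).
   Differentiating the series term by term with the Beta integral gives
   D_x^alpha v_mu = - mu v_mu, and comparing coefficients shows that the second
   Kilbas-Saigo term is eta_2 x^gam E(...) = (1 - v_mu) / mu. With mu = sqrt lambda_k
   and v_k = v_mu this means
     u_k = f_k v_k - (g_k / lambda_k) (1 - v_k),
     D_x^{2 alpha} u_k = (lambda_k f_k + g_k) v_k,
   so that every estimate follows from Parseval's identity, 0 <= v_k <= 1 and
   eta_3 <= eta_2; the latter holds because Gamma p / Gamma (p + alpha) =
   B(p, alpha) / Gamma alpha decreases in p.
   At a point where a function attains its minimum over ]0, x] its Caputo
   derivative is nonpositive. Hence h >= 0 as soon as h(0) >= 0 and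
   D_x^alpha h >= - mu h. Applied to v_mu and 1 - v_mu this gives 0 <= v_mu <= 1;
   applied to v_mu - v_mu' with mu <= mu' it shows that v_mu decreases in mu x^gam,
   so v_k(x) converges as x tends to infinity, uniformly in k since
   lambda_k >= lambda_0. *)
Require Import Defs.
From HB Require Import structures.
From mathcomp Require Import all_boot all_order all_algebra.
From mathcomp Require Import all_classical all_reals all_analysis.
From mathcomp Require Import measurable_realfun.
From mathcomp Require Import ring lra.
Set Implicit Arguments.
Unset Strict Implicit.
Unset Printing Implicit Defensive.
Import Order.TTheory GRing.Theory Num.Theory.
Import numFieldNormedType.Exports.
Local Open Scope classical_set_scope.
Local Open Scope ring_scope.

(** * The Gamma and Beta integrals *)

Section affine_change_of_variables.
Context (R : realType).
Local Notation leb := (@lebesgue_measure R).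

(** [Gamma] is a bare Lebesgue integral, so its theory is built from one identity, Gamma p * Gamma q
    = Gamma (p + q) * B(p, q), proved by Tonelli for nonnegative extended-real integrals before
    anything is known to be finite. Taking q = 1 yields the functional equation; the Beta integral
    yields both the monotone ratio and the decay that makes the Kilbas-Saigo series entire. The
    bounds 0 <= v <= 1 cannot be seen on the alternating series, which is why they are derived from
    the fractional equation. The obstacle there is that v - 1 behaves like x^gam near 0, so v' is
    singular at 0 when gam < 1, while the Caputo kernel is singular at the other end; calculus is
    therefore done on the open half-line and extended by truncation. [D2u] and [Lu] are not given by
    formulas: they have to be found as L^2 sums of prescribed coefficients, hence the Riesz-Fischer
    theorem and, behind it, completeness of L^2. The limit l of v at infinity is only located in
    [0, 1], so the limit profile of u keeps l as a parameter. *)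

Definition affine (a b x : R) : measurableTypeR R := a * x + b.

Lemma measurable_affine a b :
  measurable_fun [set: measurableTypeR R] (affine a b).
Proof. by apply: measurable_funD => //; exact: measurable_funM. Qed.

Let affine_measure (a b : R) (a0 : 0 <= a) : {measure set (measurableTypeR R) -> \bar R} :=
  mscale (NngNum a0)
    (measure_function_pushforward__canonical__measure_function_Measure leb
       (measurable_affine a b)).

(** Lebesgue measure is determined by its values on half-open intervals, and the preimage of []x,
    y]] is an interval whose length is divided by [a]. *)
Lemma pushforward_affine (a b : R) (a0 : 0 < a) (A : set (measurableTypeR R)) :
  measurable A -> leb A = (a%:E * pushforward leb (affine a b) A)%E.
Proof.
move=> mA.
have a0' : 0 <= a by exact: ltW.
pose nu := affine_measure b a0'.
suff nuE X : ocitv X -> leb X = nu X by exact: (lebesgue_measure_unique nuE mA).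
move=> [[x y]/= _ <-].
rewrite /nu /affine_measure /mscale/= /pushforward/=.
have -> : affine a b @^-1` `]x, y]%classic = `](x - b) / a, (y - b) / a]%classic.
  apply/seteqP; split => t /=; rewrite /affine !in_itv/= ltr_pdivrMr// ler_pdivlMr//;
  by move=> /andP[? ?]; apply/andP; split; lra.
rewrite !lebesgue_measure_itv/= !lte_fin.
rewrite ltr_pM2r ?invr_gt0// ltrD2r.
case: ifPn => _; last by rewrite mule0.
rewrite -!EFinD -EFinM; congr EFin; field.
by rewrite gt_eqF.
Qed.

(** Nonnegative extended-real integrands allow its use before any integral is known to be finite. *)
Lemma ge0_integral_affine (a b : R) (f : R -> \bar R) : 0 < a ->
  measurable_fun [set: R] f -> (forall x, 0 <= f x)%E ->
  (\int[leb]_x f x = a%:E * \int[leb]_x f (a * x + b)%R)%E.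
Proof.
move=> a0 mf f0.
have a0' : 0 <= a by exact: ltW.
pose nu := affine_measure b a0'.
transitivity (\int[nu]_x f x)%E.
  by apply: eq_measure_integral => A mA _; exact: pushforward_affine.
rewrite ge0_integral_mscale//=.
rewrite ge0_integral_pushforward//; exact: measurable_affine.
Qed.

End affine_change_of_variables.

Section gamma_beta.
Context (R : realType).
Local Notation leb := (@lebesgue_measure R).
Implicit Types (p q s t x : R).

(* The power is cut off at 0 so that the Gamma and Beta integrals range over the
   whole line, where they can be translated, rescaled and swapped. *)
Definition pospow p s : R := if 0 < s then s `^ (p - 1) else 0.

Lemma pospow_ge0 p s : 0 <= pospow p s.
Proof. by rewrite /pospow; case: ifP => // _; exact: powR_ge0. Qed.

Lemma pospowM p s t : 0 < s -> pospow p (s * t) = s `^ (p - 1) * pospow p t.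
Proof.
move=> s0; rewrite /pospow pmulr_rgt0//; case: ifPn => t0; last by rewrite mulr0.
by rewrite powRM// ltW.
Qed.

Lemma measurable_pospow p : measurable_fun [set: R] (pospow p).
Proof.
apply: measurable_fun_if => //.
- by apply: measurable_fun_ltr => //; exact: measurable_cst.
- by apply: measurable_funTS; exact: measurable_powR.
Qed.

(* Extended-real valued, since finiteness is only derived from egammaM below. *)
Definition egamma p : \bar R := (\int[leb]_s (pospow p s * expR (- s))%:E)%E.
Definition ebeta p q : \bar R := (\int[leb]_s (pospow p s * pospow q (1 - s))%:E)%E.

Lemma egamma_ge0 p : (0 <= egamma p)%E.
Proof. by apply: integral_ge0 => s _; rewrite lee_fin mulr_ge0// pospow_ge0. Qed.

Lemma ebeta_ge0 p q : (0 <= ebeta p q)%E.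
Proof. by apply: integral_ge0 => s _; rewrite lee_fin mulr_ge0// pospow_ge0. Qed.

Lemma measurable_beta_integrand p q x :
  measurable_fun [set: R] (fun s => pospow p s * pospow q (x - s)).
Proof.
apply: measurable_funM; first exact: measurable_pospow.
apply: (measurableT_comp (measurable_pospow q)).
by apply: measurable_funB => //; exact: measurable_cst.
Qed.

Lemma measurable_gamma_integrand p :
  measurable_fun [set: R] (fun s => pospow p s * expR (- s)).
Proof.
apply: measurable_funM; first exact: measurable_pospow.
by apply: (measurableT_comp (@measurable_expR R)).
Qed.

(** Rescaling s to x s: the two powers contribute p - 1 and q - 1 to the exponent of x, the Jacobian
    contributes 1. *)
Lemma integral_pospow_conv p q x : 0 < x ->
  (\int[leb]_s (pospow p s * pospow q (x - s))%:E =
   (x `^ (p + q - 1))%:E * ebeta p q)%E.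
Proof.
move=> x0; rewrite (@ge0_integral_affine _ x 0 _ x0); last 2 first.
- by apply/measurable_EFinP; exact: measurable_beta_integrand.
- by move=> s; rewrite lee_fin mulr_ge0// pospow_ge0.
under eq_integral => s _.
  rewrite addr0 (_ : x - x * s = x * (1 - s)); last by rewrite mulrBr mulr1.
  rewrite !pospowM// mulrACA EFinM.
  over.
rewrite ge0_integralZl//=; last 3 first.
- by apply/measurable_EFinP; exact: measurable_beta_integrand.
- by move=> s _; rewrite lee_fin mulr_ge0// pospow_ge0.
- by rewrite lee_fin mulr_ge0// powR_ge0.
rewrite muleA -EFinM; congr (_%:E * _)%E.
have xD (a b : R) : x `^ (a + b) = x `^ a * x `^ b.
  by rewrite powRD// (gt_eqF x0) implybT.
by rewrite -[X in X * _]powRr1 ?ltW// -!xD; congr (_ `^ _); ring.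
Qed.

(** Tonelli for s^(p-1) (t-s)^(q-1) e^(-t) on 0 < s < t. With t innermost, a translation by s
    separates the variables; with s innermost, the convolution scales as t^(p+q-1) times the Beta
    integral. *)
Lemma egammaM p q : (egamma p * egamma q = egamma (p + q) * ebeta p q)%E.
Proof.
pose F (z : measurableTypeR R * measurableTypeR R) : \bar R :=
  (pospow p z.1 * pospow q (z.2 - z.1) * expR (- z.2))%:E.
have mF : measurable_fun setT F.
  apply/measurable_EFinP; apply: measurable_funM.
    apply: measurable_funM.
      exact: (measurableT_comp (measurable_pospow p) measurable_fst).
    apply: (measurableT_comp (measurable_pospow q)).
    by apply: measurable_funB; [exact: measurable_snd|exact: measurable_fst].
  apply: (measurableT_comp (@measurable_expR R)).
  by apply: measurableT_comp => //; exact: measurable_snd.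
have F0 z : (0 <= F z)%E by rewrite lee_fin !mulr_ge0// pospow_ge0.
transitivity (\int[leb]_s \int[leb]_t F (s, t))%E.
  rewrite /egamma -ge0_integralZr//; last 3 first.
  - by apply/measurable_EFinP; exact: measurable_gamma_integrand.
  - by move=> s _; rewrite lee_fin mulr_ge0// pospow_ge0.
  - exact: egamma_ge0.
  apply: eq_integral => s _.
  rewrite -ge0_integralZl//; last 3 first.
  - by apply/measurable_EFinP; exact: measurable_gamma_integrand.
  - by move=> t _; rewrite lee_fin mulr_ge0// pospow_ge0.
  - by rewrite lee_fin mulr_ge0// pospow_ge0.
  rewrite [LHS](@ge0_integral_affine _ 1 (- s))//; last 2 first.
  - apply: measurable_funeM.
    by apply/measurable_EFinP; exact: measurable_gamma_integrand.
  - by move=> t; rewrite mule_ge0// lee_fin mulr_ge0// pospow_ge0.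
  rewrite mul1e; apply: eq_integral => t _; rewrite -EFinM /F/= mul1r.
  rewrite mulrACA -expRD; congr (_ * expR _)%:E; ring.
rewrite (@fubini_tonelli _ _ _ _ _ leb leb F)//.
rewrite /egamma -ge0_integralZr//; last 3 first.
- by apply/measurable_EFinP; exact: measurable_gamma_integrand.
- by move=> s _; rewrite lee_fin mulr_ge0// pospow_ge0.
- exact: ebeta_ge0.
apply: eq_integral => t _; rewrite /F/=.
under eq_integral do rewrite mulrC EFinM.
rewrite (ge0_integralZl leb measurableT) /=; last 3 first.
- by apply/measurable_EFinP; exact: measurable_beta_integrand.
- by move=> s _; rewrite lee_fin mulr_ge0// pospow_ge0.
- by rewrite lee_fin expR_ge0.
have [t0|t0] := ltP 0 t.
  rewrite integral_pospow_conv// muleA -EFinM mulrC.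
  by congr (_%:E * _)%E; rewrite /pospow t0.
rewrite [pospow (p + q) t]/pospow ltNge t0/= mul0r mul0e.
rewrite integral0_eq ?mule0// => s _; rewrite /pospow; congr EFin.
case: ifPn => s0; last by rewrite mul0r.
by rewrite ltNge (_ : t - s <= 0) ?mulr0//; lra.
Qed.

End gamma_beta.

(** The margin between [[a, b]] and []l, r[] makes the fundamental theorem applicable to functions
    that are singular at [l] or [r]. *)
Lemma integral_derive_itv (R : realType) (F f : R -> R) (l r a b : R) :
  l < a -> a < b -> b < r ->
  (forall x, l < x < r -> is_derive x 1 F (f x)) ->
  (forall x, l < x < r -> {for x, continuous f}) ->
  (\int[@lebesgue_measure R]_(x in `[a, b]) (f x)%:E = (F b - F a)%:E)%E.
Proof.
move=> la ab br dF cf.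
have lr x : x \in `[a, b] -> l < x < r.
  by rewrite in_itv/= => /andP[ax xb]; rewrite (lt_le_trans la)//= (le_lt_trans xb).
have cF x : l < x < r -> {for x, continuous F}.
  move=> /dF [dFx _]; apply: differentiable_continuous.
  exact/derivable1_diffP.
rewrite (@continuous_FTC2 R f F)//.
- apply: continuous_in_subspaceT => x; rewrite inE/= => /lr; exact: cf.
- split.
  + by move=> x /subset_itv_oo_cc /lr /dF [].
  + by apply: cvg_at_right_filter; apply: cF; apply: lr; rewrite in_itv/= lexx ltW.
  + by apply: cvg_at_left_filter; apply: cF; apply: lr; rewrite in_itv/= lexx ltW.
- by move=> x /subset_itv_oo_cc /lr /dF xF; rewrite derive1E derive_val.
Qed.

(** * Functional equation, finiteness, positivity and ratios of Gamma *)

Section gamma_function.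
Context (R : realType).
Local Notation leb := (@lebesgue_measure R).
Implicit Types (p q s t x : R).

Lemma integral_expN : (\int[leb]_(s in `]0%R, +oo[) (expR (- s))%:E = 1)%E.
Proof.
have cE : continuous (fun s : R => expR (- s)).
  by move=> s; apply: continuous_comp; [exact: opp_continuous|exact: continuous_expR].
have dE s : is_derive s 1 (fun s : R => - expR (- s)) (expR (- s)).
  by apply: is_derive_eq; rewrite mulrN1 opprK.
rewrite integral_itv_obnd_cbnd; last first.
  by apply: measurable_funTS; exact/measurable_EFinP/(measurableT_comp (@measurable_expR R)).
rewrite (@ge0_continuous_FTC2y R (fun s => expR (- s)) (fun s => - expR (- s)) 0 0).
- by rewrite oppr0 expR0 EFinN oppeK add0e.
- by move=> s _; exact: expR_ge0.
- by exact: continuous_subspaceT.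
- rewrite -oppr0; apply: cvgN; exact: cvgr_expR.
- by move=> s _; apply: ex_derive.
- by apply: cvg_at_right_filter; apply: cvgN; exact: cE.
- by move=> s _; rewrite derive1E derive_val.
Qed.

Lemma egammaE p :
  egamma p = (\int[leb]_(t in `]0%R, +oo[) (t `^ (p - 1) * expR (- t))%:E)%E.
Proof.
rewrite [RHS]integral_mkcond; apply: eq_integral => s _.
rewrite patchE mem_setE in_itv/= andbT /pospow; case: ifP => //.
by rewrite mul0r.
Qed.

(* Locked because unification otherwise unfolds the integral. *)
Definition gammaf p : R := locked (@Gamma R) p.

Lemma Gamma_gammaf p : Gamma p = gammaf p.
Proof. by rewrite /gammaf -lock. Qed.

Lemma gammafE p : gammaf p = fine (egamma p).
Proof. by rewrite -Gamma_gammaf /Gamma /Rintegral egammaE. Qed.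

Lemma egamma1 : egamma 1 = 1%E :> \bar R.
Proof.
rewrite egammaE -integral_expN; apply: eq_integral => s _.
by rewrite subrr powRr0 mul1r.
Qed.

Lemma ebeta1 p : 0 < p -> ebeta p 1 = (p^-1)%:E.
Proof.
move=> p0.
have -> : ebeta p 1 = (\int[leb]_(s in `]0%R, 1%R[) (s `^ (p - 1))%:E)%E.
  rewrite [RHS]integral_mkcond; apply: eq_integral => s _.
  rewrite patchE mem_setE in_itv/= /pospow subr_gt0; case: ifP => s0; last by rewrite mul0r.
  by case: ifP => _; rewrite ?mulr0// subrr powRr0 mulr1.
have mf : measurable_fun [set: R] (fun s => (s `^ (p - 1))%:E).
  by apply/measurable_EFinP; exact: measurable_powR.
rewrite integral_itv_bndo_bndc; last exact: measurable_funTS.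
(* For p < 1 the integrand is unbounded at 0, so ]0, 1] is exhausted from inside by monotone
   convergence; [n.+2] keeps every interval nondegenerate, even at n = 0. *)
pose F (n : nat) := `[(n.+2%:R : R)^-1, 1%R]%classic.
have -> : `]0%R, 1%R]%classic = \bigcup_n F n.
  apply/seteqP; split => x /=.
    rewrite in_itv/= => /andP[x0 x1].
    exists (Num.truncn x^-1) => //=; rewrite /F/= in_itv/= x1 andbT.
    rewrite invf_ple// ?posrE//.
    apply: ltW; apply: (lt_le_trans (truncnS_gt _)).
    by rewrite ler_nat.
  move=> [n _]; rewrite /F/= !in_itv/= => /andP[nx ->]; rewrite andbT.
  by rewrite (lt_le_trans _ nx)// invr_gt0.
have FE n : (\int[leb]_(x in F n) (x `^ (p - 1))%:E = (p^-1 * (1 - (n.+2%:R^-1) `^ p))%:E)%E.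
  have dF x : 0 < x < 2 -> is_derive x 1 (fun s : R => p^-1 * s `^ p) (x `^ (p - 1)).
    move=> /andP[x0 _]; have := is_deriveZ p^-1 (is_derive1_powR p x0).
    by rewrite /GRing.scale/= mulrA mulVf ?mul1r ?gt_eqF.
  have cf x : 0 < x < 2 -> {for x, continuous (fun s : R => s `^ (p - 1))}.
    move=> /andP[x0 _]; apply: differentiable_continuous; apply/derivable1_diffP.
    by apply: derivable_powR; rewrite in_itv/= andbT.
  rewrite (integral_derive_itv _ _ _ dF cf) ?ltr1n//.
  - by rewrite -mulrBr powR1.
  - by rewrite invf_lt1// ltr1n.
have /cvg_lim <- // : (\int[leb]_(x in F n) (x `^ (p - 1))%:E @[n --> \oo] -->
    \int[leb]_(x in \bigcup_n F n) (x `^ (p - 1))%:E)%E.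
  apply: ge0_nondecreasing_set_cvg_integral => //.
  - apply/nondecreasing_seqP => n; apply/subsetPset => x; rewrite /F/= !in_itv/= => /andP[nx ->].
    by rewrite andbT (le_trans _ nx)// lef_pV2 ?posrE// ler_nat.
  - by move=> n; exact: measurable_itv.
  - by move=> n; exact: measurable_funTS.
  - by move=> n x _; rewrite lee_fin powR_ge0.
apply/cvg_lim => //; under eq_fun do rewrite FE.
apply: cvg_EFin; first exact: nearW.
rewrite -[X in _ --> X]mulr1; apply: cvgMr.
rewrite -[X in _ --> X]subr0; apply: cvgB; first exact: cvg_cst.
have /cvg_at_rightP := powR_cvg0 p0; apply; split; first by move=> n; rewrite invr_gt0.
by have := @cvg_harmonic R; rewrite -(@cvg_shiftS R); exact.
Qed.

(** This is [egammaM] at q = 1, as Gamma 1 = 1 and B(p, 1) = 1 / p; no integration by parts is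
    involved. *)
Lemma egammaS p : 0 < p -> (egamma (p + 1) = p%:E * egamma p)%E.
Proof.
move=> p0; have := egammaM p (1 : R); rewrite egamma1 mule1 ebeta1// => ->.
by rewrite muleCA -EFinM divff ?mule1// gt_eqF.
Qed.

Lemma egamma_nat (n : nat) : (egamma (n.+1%:R : R) < +oo)%E.
Proof.
elim: n => [|n ih]; first by rewrite egamma1 ltry.
by rewrite -natr1 egammaS// lte_mul_pinfty.
Qed.

(** s^(p-1) is at most 1 for s <= 1 and at most s^n for s > 1, where n + 1 >= p; this bounds the
    integral by two Gamma values at positive integers. *)
Lemma egamma_ge1_lty p : 1 <= p -> (egamma p < +oo)%E.
Proof.
move=> p1; pose n := Num.truncn p.
have pn : p <= n.+1%:R by apply: ltW; exact: truncnS_gt.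
have mI q : measurable_fun [set: R] (fun s => (pospow q s * expR (- s))%:E).
  by apply/measurable_EFinP; exact: (measurable_gamma_integrand q).
have I0 q s : (0 <= (pospow q s * expR (- s))%:E)%E.
  by rewrite lee_fin mulr_ge0// pospow_ge0.
apply: (@le_lt_trans _ _ (egamma 1 + egamma (n.+1%:R : R))%E); last first.
  by rewrite lte_add_pinfty// ?egamma1 ?ltry// egamma_nat.
rewrite /egamma -ge0_integralD//; [|exact: mI|exact: mI].
apply: ge0_le_integral => //.
- exact: mI.
- by apply: emeasurable_funD; exact: mI.
- move=> s _; rewrite -EFinD lee_fin -mulrDl ler_wpM2r ?expR_ge0// /pospow.
  case: ifPn => s0; last by rewrite addr0.
  rewrite subrr powRr0; have [s1|s1] := leP s 1.
    apply: (@le_trans _ _ 1); last by rewrite lerDl powR_ge0.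
    have := @ger_powR _ s; rewrite s0 s1 => /(_ erefl 0 (p - 1)).
    by rewrite powRr0; apply; rewrite subr_ge0.
  apply: (@le_trans _ _ (s `^ (n.+1%:R - 1))); last by rewrite lerDr.
  by apply: ler_powR; [exact: ltW|rewrite lerD2r].
Qed.

Lemma egamma_lty p : 0 < p -> (egamma p < +oo)%E.
Proof.
move=> p0; have : (egamma (p + 1) < +oo)%E by apply: egamma_ge1_lty; rewrite lerDr ltW.
rewrite egammaS//; case: (egamma p) (egamma_ge0 p) => [r _ _||//] //; first by rewrite ltry.
by rewrite mulry gtr0_sg// mul1e.
Qed.

(** On [1, 2] the integrand is at least c = 2^(-|p-1|) e^(-2). *)
Lemma egamma_gt0 p : (0 < egamma p)%E.
Proof.
pose c : R := expR (- (`|p - 1| * ln 2)) * expR (- 2).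
have c0 : 0 < c by rewrite mulr_gt0// expR_gt0.
apply: (@lt_le_trans _ _ (\int[leb]_(s in `[1%R, 2%R]) c%:E)%E).
  rewrite integral_cst//= lebesgue_measure_itv/= lte_fin ltr1n -EFinB.
  by rewrite (_ : 2 - 1 = 1 :> R) ?mule1 ?lte_fin//; lra.
rewrite integral_mkcond; apply: ge0_le_integral => //.
- by move=> s _; rewrite patchE; case: ifPn => // _; rewrite lee_fin ltW.
- have mc : measurable_fun (`[1%R, 2%R]%classic : set (measurableTypeR R)) (fun=> c%:E : \bar R) by exact: measurable_cst.
  exact: (measurable_restrictT _ (measurable_itv _)).1 mc.
- by apply/measurable_EFinP; exact: (measurable_gamma_integrand p).
- move=> s _; rewrite patchE mem_setE in_itv/=; case: ifPn => [/andP[s1 s2]|_]; last first.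
    by rewrite lee_fin mulr_ge0// pospow_ge0.
  have s0 : 0 < s by exact: lt_le_trans s1.
  rewrite lee_fin /c /pospow s0 ler_pM ?expR_ge0// ?ler_expR ?lerN2//.
  rewrite /powR gt_eqF// ler_expR lerNl -mulNr.
  rewrite (@le_trans _ _ (`|p - 1| * ln s))//.
    by rewrite ler_wpM2r ?ln_ge0// -normrN ler_norm.
  by rewrite ler_wpM2l// ler_ln ?posrE.
Qed.

Lemma egamma_fin p : 0 < p -> egamma p = (gammaf p)%:E.
Proof.
by move=> p0; rewrite gammafE fineK// ge0_fin_numE ?egamma_lty// egamma_ge0.
Qed.

Lemma gammaf_gt0 p : 0 < p -> 0 < gammaf p.
Proof. by move=> p0; rewrite -lte_fin -egamma_fin// egamma_gt0. Qed.

Lemma gammafS p : 0 < p -> gammaf (p + 1) = p * gammaf p.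
Proof.
move=> p0; apply: EFin_inj.
by rewrite EFinM -(egamma_fin (addr_gt0 p0 ltr01)) -(egamma_fin p0) egammaS.
Qed.

(** Finiteness of [ebeta] comes with the division: an infinite value in [egammaM] would contradict
    the finite product of Gammas. *)
Lemma ebetaE p q : 0 < p -> 0 < q ->
  ebeta p q = (gammaf p * gammaf q / gammaf (p + q))%:E.
Proof.
move=> p0 q0; have pq0 : 0 < p + q by rewrite addr_gt0.
have := egammaM p q; rewrite !egamma_fin// -EFinM.
have /gt_eqF G0 := gammaf_gt0 pq0.
have := ebeta_ge0 p q; case: (ebeta p q) => [r _ /eqP||] //.
- by rewrite -EFinM eqe => /eqP ->; rewrite mulrAC divff ?mul1r// G0.
- by move=> _; rewrite mulry gtr0_sg ?gammaf_gt0// mul1e.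
Qed.

Lemma le_gammaf_ratio (a p q : R) : 0 < a -> 0 < p -> p <= q ->
  gammaf q / gammaf (q + a) <= gammaf p / gammaf (p + a).
Proof.
move=> a0 p0 pq; have q0 : 0 < q by exact: lt_le_trans pq.
rewrite -(ler_pM2r (gammaf_gt0 a0)) ![_ / _ * _]mulrAC -lee_fin.
rewrite -(ebetaE q0 a0) -(ebetaE p0 a0).
apply: ge0_le_integral => //.
- by move=> s _; rewrite lee_fin mulr_ge0// pospow_ge0.
- by apply/measurable_EFinP; exact: (measurable_beta_integrand q a 1).
- by apply/measurable_EFinP; exact: (measurable_beta_integrand p a 1).
- move=> s _; rewrite lee_fin /pospow subr_gt0.
  case: ifPn => s0; last by rewrite !mul0r.
  case: ifPn => s1; last by rewrite !mulr0.
  rewrite ler_wpM2r ?powR_ge0//.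
  have := @ger_powR _ s; rewrite s0 (ltW s1) => /(_ erefl); apply.
  by rewrite lerD2r.
Qed.

(** Up to the factor Gamma a the ratio is B(n b + c, a), whose integrand tends to 0 on ]0, 1[ like
    s^(n b). Since c >= 1, the integrand with first parameter 1 is an integrable majorant for all
    n. *)
Lemma cvg_gammaf_ratio (a b c : R) : 0 < a -> 0 < b -> 1 <= c ->
  (fun n : nat => gammaf (n%:R * b + c) / gammaf (n%:R * b + c + a)) @ \oo --> (0 : R).
Proof.
move=> a0 b0 c1.
have c0 : 0 < c by exact: lt_le_trans c1.
have nbc0 (n : nat) : 0 < n%:R * b + c by rewrite ltr_wpDl// mulr_ge0// ltW.
suff: (fun n : nat => ebeta (n%:R * b + c) a) @ \oo --> (0 : R)%:E.
  move=> h; have /fine_cvgP[_] : (fun n : nat => (gammaf a)^-1%:E * ebeta (n%:R * b + c) a)%E @ \oo --> (0 : R)%:E.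
    rewrite -[X in _ --> X](mule0 (gammaf a)^-1%:E); exact: cvgeZl.
  apply: cvg_trans; apply: near_eq_cvg; apply: nearW => n /=.
  rewrite ebetaE//=.
  have /gt_eqF Ga := gammaf_gt0 a0.
  have /gt_eqF Gb : 0 < gammaf (n%:R * b + c + a) by rewrite gammaf_gt0// addr_gt0.
  move: (gammaf a) (gammaf _) (gammaf _) Ga Gb => u v w u0 w0.
  by field; rewrite u0 w0.
have := @dominated_cvg _ _ R leb setT measurableT
  (fun n s => (pospow (n%:R * b + c) s * pospow a (1 - s))%:E) (cst 0%E)
  (fun s => (pospow 1 s * pospow a (1 - s))%:E).
rewrite integral0; apply => //.
- by move=> n; apply/measurable_EFinP; exact: (measurable_beta_integrand _ a 1).
- move=> s _; apply: cvg_EFin; first exact: nearW.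
  rewrite /comp/= /pospow subr_gt0.
  case: ifPn => s1; last first.
    by under eq_fun do rewrite mulr0; exact: cvg_cst.
  have [s0|s0] := ltP 0 s; last first.
    by under eq_fun do rewrite mul0r; exact: cvg_cst.
  rewrite -[X in _ --> X](mul0r ((1 - s) `^ (a - 1))); apply: cvgMl.
  have sb1 : `|s `^ b| < 1.
    rewrite ger0_norm ?powR_ge0// (_ : 1 = 1 `^ b); last by rewrite powR1.
    by rewrite gt0_ltr_powR// nnegrE ltW.
  have := @cvg_expr _ _ sb1.
  apply: (@squeeze_cvgr _ _ _ _ (cst 0)); last exact: cvg_cst.
  apply: nearW => n; rewrite powR_ge0/=.
  rewrite -powR_mulrn ?powR_ge0// -powRrM mulrC.
  have := @ger_powR _ s; rewrite s0 (ltW s1) => /(_ erefl); apply.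
  by rewrite mulrC -addrA lerDl subr_ge0.
- apply/integrableP; split.
    by apply/measurable_EFinP; exact: (measurable_beta_integrand 1 a 1).
  under eq_integral do rewrite gee0_abs ?lee_fin ?mulr_ge0 ?pospow_ge0//.
  by rewrite -/(ebeta 1 a) ebetaE// ltry.
- move=> n s _; rewrite abse_EFin lee_fin ger0_norm ?mulr_ge0 ?pospow_ge0//.
  rewrite /pospow subr_gt0 subrr powRr0.
  case: ifPn => s0; last by rewrite !mul0r.
  case: ifPn => s1; last by rewrite !mulr0.
  rewrite ler_wpM2r ?powR_ge0//.
  have := @ger_powR _ s; rewrite s0 (ltW s1) => /(_ erefl 0 (n%:R * b + c - 1)).
  by rewrite powRr0; apply; rewrite -addrA addr_ge0 ?subr_ge0// mulr_ge0// ltW.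
Qed.

End gamma_function.

(** * The Kilbas-Saigo function and its Caputo derivative *)

Section power_series_ratio.
Context (R : realType).
Implicit Types c : R^nat.

(** A sufficient condition for an infinite radius of convergence that survives termwise
    differentiation. Positivity makes the series at |z| a majorant of the series at z. *)
Definition entire_coef c :=
  (forall j, 0 < c j) /\ (fun j => c j.+1 / c j) @ \oo --> (0 : R).

(** From the rank N on, consecutive coefficients have ratio at most 1 / r, so the terms c_j r^j
    decrease; the sum of the terms up to N bounds them all. *)
Lemma entire_coef_bounded c (r : R) : entire_coef c -> 0 < r ->
  exists K, forall j, c j * r ^+ j <= K.
Proof.
move=> [c0 cr] r0.
have ri0 : 0 < r^-1 by rewrite invr_gt0.
have /cvgrPdist_le/(_ _ ri0) [N _ HN] := cr.
exists (\sum_(0 <= i < N.+1) c i * r ^+ i) => j.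
have t0 i : 0 <= c i * r ^+ i by rewrite mulr_ge0 ?exprn_ge0 ?ltW.
have small i : (i <= N)%N -> c i * r ^+ i <= \sum_(0 <= i < N.+1) c i * r ^+ i.
  move=> iN; rewrite big_mkord (bigD1 (Ordinal (iN : (i < N.+1)%N)))//= lerDl.
  by apply: sumr_ge0.
have [jN|jN] := leqP j N; first exact: small.
apply: (@le_trans _ _ (c N * r ^+ N)); last exact: small.
rewrite -(subnKC (ltnW jN)); elim: (j - N)%N => [|k ih]; first by rewrite addn0.
apply: le_trans ih; rewrite addnS exprS mulrA ler_wpM2r ?exprn_ge0 ?(ltW r0)//.
have := HN (N + k)%N (leq_addr _ _); rewrite sub0r normrN ger0_norm; last first.
  by rewrite divr_ge0 ?ltW.
by rewrite ler_pdivrMr// => h; rewrite -ler_pdivlMr// mulrC.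
Qed.

Lemma entire_coef_cvg c (z : R) : entire_coef c -> cvgn (pseries c z).
Proof.
(* This radius is positive even for z = 0 and satisfies |z| / r < 1, which gives a geometric
   majorant. *)
move=> ec; pose r := 2 * `|z| + 1.
have r0 : 0 < r by rewrite ltr_wpDl// mulr_ge0.
have [K cK] := entire_coef_bounded ec r0.
apply: normed_cvg; apply: (@series_le_cvg _ _ (geometric K (`|z| / r))).
- by move=> n /=; exact: normr_ge0.
- move=> n /=; rewrite mulr_ge0 ?exprn_ge0 ?divr_ge0 ?(ltW r0)//.
  by apply: le_trans (cK 0%N); rewrite expr0 mulr1 ltW// ec.1.
- move=> n /=; rewrite normrM normrX gtr0_norm ?ec.1// expr_div_n.
  have := cK n; rewrite -ler_pdivlMr ?exprn_gt0// => h.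
  apply: le_trans (ler_wpM2r (exprn_ge0 n (normr_ge0 z)) h) _.
  by rewrite mulrAC mulrA.
- apply: is_cvg_geometric_series; rewrite ger0_norm ?divr_ge0 ?(ltW r0)//.
  rewrite ltr_pdivrMr// mul1r /r; have := normr_ge0 z; lra.
Qed.

(** The new ratio is the old one, shifted, times (j + 2) / (j + 1) <= 2. *)
Lemma entire_coef_diffs c : entire_coef c -> entire_coef (pseries_diffs c).
Proof.
move=> [c0 cr]; split=> [j|]; first by rewrite /pseries_diffs mulr_gt0.
have cr1 : (fun j => c j.+2 / c j.+1) @ \oo --> (0 : R).
  by rewrite (cvg_shiftS (fun j => c j.+1 / c j)).
apply: (@squeeze_cvgr _ _ _ _ (cst 0) (fun j => 2 * (c j.+2 / c j.+1))).
- apply: nearW => j; rewrite /pseries_diffs divr_ge0 ?mulr_ge0 ?(ltW (c0 _))//=.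
  rewrite invfM mulrACA ler_wpM2r ?divr_ge0 ?(ltW (c0 _))// ler_pdivrMr//.
  by rewrite -natrM ler_nat mul2n -addnn addSnnS leq_addl.
- exact: cvg_cst.
- by rewrite -[X in _ --> X](mulr0 2); apply: cvgMr.
Qed.

Lemma is_derive_entire c (z : R) : entire_coef c ->
  is_derive z 1 (fun z => limn (pseries c z)) (limn (pseries (pseries_diffs c) z)).
Proof.
move=> ec; apply: (@pseries_snd_diffs _ c (`|z| + 1) z).
- exact: entire_coef_cvg.
- by apply: entire_coef_cvg; exact: entire_coef_diffs.
- by apply: entire_coef_cvg; do 2 apply: entire_coef_diffs.
- by rewrite [ltRHS]ger0_norm ?addr_ge0// ltrDl.
Qed.

Lemma continuous_entire c : entire_coef c ->
  continuous (fun z => limn (pseries c z)).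
Proof.
move=> ec z; apply: differentiable_continuous; apply/derivable1_diffP.
by have [] := is_derive_entire z ec.
Qed.

(** Supplies the bound independent of n that dominated convergence requires. *)
Lemma entire_partial_sum_le c (z w : R) n : entire_coef c -> `|z| <= w ->
  `|pseries c z n| <= limn (pseries c w).
Proof.
move=> ec zw; have w0 : 0 <= w by exact: le_trans zw.
have t0 i : 0 <= c i * w ^+ i by rewrite mulr_ge0 ?exprn_ge0// ltW// ec.1.
apply: (@le_trans _ _ (pseries c w n)).
  apply: le_trans (ler_norm_sum _ _ _) _; apply: ler_sum => i _.
  rewrite normrM normrX gtr0_norm ?ec.1// ler_wpM2l ?(ltW (ec.1 _))//.
  by rewrite lerXn2r ?nnegrE.
apply: nondecreasing_cvgn_le; last exact: entire_coef_cvg.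
by apply/nondecreasing_seqP => k; rewrite /pseries /series/= [leRHS]big_nat_recr//= lerDl.
Qed.

End power_series_ratio.

Section kilbas_saigo_coefficients.
Context (R : realType) (alpha beta : R).
Hypothesis (alpha_gt0 : 0 < alpha) (beta_ge0 : 0 <= beta).
Local Notation gam := (alpha + beta).

Definition ks_coef := kilbas_saigo_coef alpha (1 + beta / alpha) (beta / alpha).

(** The factor of the Kilbas-Saigo product after multiplying out [alpha]: with m = 1 + beta / alpha
    and n = beta / alpha, the argument alpha (j m + n) + 1 is j gam + beta + 1. *)
Definition ks_ratio (j : nat) : R :=
  gammaf (j%:R * gam + (beta + 1)) / gammaf (j%:R * gam + (beta + 1) + alpha).

Lemma ks_gam_gt0 : 0 < gam.
Proof. by rewrite ltr_wpDr. Qed.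

Lemma ks_coef0 : ks_coef 0 = 1.
Proof. by rewrite /ks_coef /kilbas_saigo_coef big_nil. Qed.

Lemma ks_coefS j : ks_coef j.+1 = ks_coef j * ks_ratio j.
Proof.
have a0 : alpha != 0 by rewrite gt_eqF.
rewrite /ks_coef /kilbas_saigo_coef (big_nat_recr _ _ _ (leq0n j)) /= !Gamma_gammaf /ks_ratio.
set m := 1 + beta / alpha.
have -> : alpha * (j%:R * m + beta / alpha) + 1 = j%:R * gam + (beta + 1).
  by rewrite /m; field.
have -> : alpha * (j%:R * m + beta / alpha + 1) + 1 = j%:R * gam + (beta + 1) + alpha.
  by rewrite /m; field.
by [].
Qed.

Lemma ks_arg_gt0 j : 0 < j%:R * gam + (beta + 1).
Proof. by rewrite ltr_wpDl ?ltr_wpDl// mulr_ge0// ltW// ks_gam_gt0. Qed.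

Lemma ks_ratio_gt0 j : 0 < ks_ratio j.
Proof.
have h := ks_arg_gt0 j.
by rewrite divr_gt0// gammaf_gt0// addr_gt0.
Qed.

Lemma ks_coef_gt0 j : 0 < ks_coef j.
Proof.
by elim: j => [|j ih]; rewrite ?ks_coef0// ks_coefS mulr_gt0// ks_ratio_gt0.
Qed.

Lemma ks_entire : entire_coef ks_coef.
Proof.
split; first exact: ks_coef_gt0.
have := @cvg_gammaf_ratio R alpha gam (beta + 1) alpha_gt0 ks_gam_gt0.
rewrite lerDr => /(_ beta_ge0); apply: cvg_trans; apply: near_eq_cvg.
apply: nearW => j /=; rewrite ks_coefS mulrAC divff ?mul1r.
  by [].
by rewrite gt_eqF// ks_coef_gt0.
Qed.

Lemma ks_coef1 : ks_coef 1 = eta2 alpha beta.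
Proof.
rewrite ks_coefS ks_coef0 mul1r /ks_ratio /eta2 !Gamma_gammaf mul0r add0r.
by rewrite (addrC beta 1) (addrAC 1 beta).
Qed.

(** Since 1 + 2 beta / alpha = m + beta / alpha, the second product is the first one with its
    initial factor removed, and that factor is [eta2]. *)
Lemma ks_coef_shift j :
  eta2 alpha beta *
    kilbas_saigo_coef alpha (1 + beta / alpha) (1 + 2 * beta / alpha) j =
  ks_coef j.+1.
Proof.
elim: j => [|j ih]; first by rewrite /kilbas_saigo_coef big_nil mulr1 ks_coef1.
have a0 : alpha != 0 by rewrite gt_eqF.
rewrite ks_coefS -ih /kilbas_saigo_coef (big_nat_recr _ _ _ (leq0n j)) /= !Gamma_gammaf mulrA /ks_ratio.
set m := 1 + beta / alpha; set n := 1 + 2 * beta / alpha.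
have -> : alpha * (j%:R * m + n) + 1 = j.+1%:R * gam + (beta + 1).
  by rewrite /m /n -natr1; field.
have -> : alpha * (j%:R * m + n + 1) + 1 = j.+1%:R * gam + (beta + 1) + alpha.
  by rewrite /m /n -natr1; field.
by [].
Qed.

Definition ks z := limn (pseries ks_coef z).

Lemma ksE z : kilbas_saigo alpha (1 + beta / alpha) (beta / alpha) z = ks z.
Proof. by []. Qed.

Lemma ks_second z :
  eta2 alpha beta * z *
    kilbas_saigo alpha (1 + beta / alpha) (1 + 2 * beta / alpha) z = ks z - 1.
Proof.
set c2 := kilbas_saigo_coef alpha (1 + beta / alpha) (1 + 2 * beta / alpha).
have ksS n : pseries ks_coef z n.+1 = 1 + eta2 alpha beta * z * pseries c2 z n.
  rewrite /pseries/= /series/= big_nat_recl// ks_coef0 expr0 mulr1; congr (_ + _).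
  rewrite mulr_sumr; apply: eq_bigr => i _.
  by rewrite -ks_coef_shift -/c2 exprS; ring.
have ks_cvg : (fun n => 1 + eta2 alpha beta * z * pseries c2 z n) @ \oo --> ks z.
  rewrite -(_ : (fun n => pseries ks_coef z n.+1) = (fun n => _)); last exact/funext.
  by rewrite (cvg_shiftS (pseries ks_coef z)); exact: entire_coef_cvg ks_entire.
(* Convergence of the second series is obtained from the first by dividing by eta2 z, hence the
   separate case z = 0. *)
have [z0|z0] := eqVneq z 0.
  have e0 : eta2 alpha beta * z = 0 by rewrite z0 mulr0.
  move: ks_cvg; under eq_fun do rewrite e0 mul0r addr0.
  by rewrite e0 mul0r => /cvg_lim <- //; rewrite lim_cst// subrr.
have e0 : eta2 alpha beta * z != 0.
  by rewrite mulf_neq0// -ks_coef1 gt_eqF// ks_coef_gt0.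
have h : (fun n => (eta2 alpha beta * z)^-1 * (1 + eta2 alpha beta * z * pseries c2 z n - 1))
    @ \oo --> (eta2 alpha beta * z)^-1 * (ks z - 1).
  by apply: cvgMr; apply: cvgB => //; exact: cvg_cst.
have : pseries c2 z @ \oo --> (eta2 alpha beta * z)^-1 * (ks z - 1).
  apply: cvg_trans h; apply: near_eq_cvg; apply: nearW => n /=.
  by rewrite addrAC subrr add0r mulrA (mulVf e0) mul1r.
move/cvg_lim; rewrite /kilbas_saigo => -> //.
by rewrite mulrA divff ?mul1r.
Qed.

End kilbas_saigo_coefficients.

(** * Termwise fractional integration of a power series in s^gam *)

Section caputo_of_series.
Context (R : realType).
Local Notation leb := (@lebesgue_measure R).
Implicit Types (c : R^nat) (p q gam w s x : R).

Lemma pospow_powR p s : 0 < s -> pospow p s = s `^ (p - 1).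
Proof. by move=> s0; rewrite /pospow s0. Qed.

Lemma pospow_le0 p s : s <= 0 -> pospow p s = 0.
Proof. by move=> s0; rewrite /pospow ltNge s0. Qed.

Lemma powR_gt0D (a b s : R) : 0 < s -> s `^ (a + b) = s `^ a * s `^ b.
Proof. by move=> s0; rewrite powRD// (gt_eqF s0) implybT. Qed.

Definition convol p q x s : R := pospow p s * pospow q (x - s).

Lemma convol_ge0 p q x s : 0 <= convol p q x s.
Proof. by rewrite mulr_ge0 ?pospow_ge0. Qed.

Lemma convol_out p q x s : ~~ (0 < s < x) -> convol p q x s = 0.
Proof.
rewrite negb_and -!leNgt => /orP[s0|xs]; first by rewrite /convol pospow_le0 ?mul0r.
by rewrite /convol [pospow q _]pospow_le0 ?mulr0 ?subr_le0.
Qed.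

Lemma integral_convol p q x : 0 < p -> 0 < q -> 0 < x ->
  (\int[leb]_s (convol p q x s)%:E =
   (x `^ (p + q - 1) * (gammaf p * gammaf q / gammaf (p + q)))%:E)%E.
Proof.
move=> p0 q0 x0; rewrite EFinM -(ebetaE p0 q0).
exact: (integral_pospow_conv p q x0).
Qed.

Lemma integrable_convol p q x : 0 < p -> 0 < q -> 0 < x ->
  leb.-integrable setT (fun s => (convol p q x s)%:E).
Proof.
move=> p0 q0 x0; apply/integrableP; split.
  by apply/measurable_EFinP; exact: (measurable_beta_integrand p q x).
under eq_integral do rewrite (gee0_abs (_ : 0 <= (convol p q x _)%:E)%E) ?lee_fin ?convol_ge0//.
by rewrite integral_convol// ltry.
Qed.

Definition series_powR c gam w s : R := limn (pseries c (w * s `^ gam)).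

(** The chain-rule derivative of [series_powR] at s > 0. For gam < 1 the factor s^(gam-1) is
    unbounded at 0, but integrable because gam > 0. *)
Definition series_powR' c gam w s : R :=
  limn (pseries (pseries_diffs c) (w * s `^ gam)) * (w * (gam * s `^ (gam - 1))).

Lemma is_derive_series_powR c gam w s : entire_coef c -> 0 < s ->
  is_derive s 1 (series_powR c gam w) (series_powR' c gam w s).
Proof.
move=> ec s0.
have dg : is_derive s 1 (fun s => w * s `^ gam) (w * (gam * s `^ (gam - 1))).
  exact: (is_deriveZ w (is_derive1_powR gam s0)).
have := @is_derive1_comp R (fun z => limn (pseries c z)) (fun s => w * s `^ gam) s _ _
  (is_derive_entire _ ec) dg.
exact.
Qed.

Lemma continuous_powR_gt0 p s : 0 < s -> {for s, continuous (fun t : R => t `^ p)}.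
Proof.
move=> s0; apply: differentiable_continuous; apply/derivable1_diffP.
by apply: derivable_powR; rewrite in_itv/= s0.
Qed.

Lemma continuous_series_powR' c gam w s : entire_coef c -> 0 < s ->
  {for s, continuous (series_powR' c gam w)}.
Proof.
move=> ec s0; apply: continuousM.
  apply: (@continuous_comp _ _ _ (fun s => w * s `^ gam)
     (fun z => limn (pseries (pseries_diffs c) z))).
    by apply: continuousM; [exact: cvg_cst|exact: continuous_powR_gt0].
  by apply: continuous_entire; exact: entire_coef_diffs.
apply: continuousM; first exact: cvg_cst.
by apply: continuousM; [exact: cvg_cst|exact: continuous_powR_gt0].
Qed.

(** Up to the factor 1 / Gamma q this is the Riemann-Liouville integral of order q of the
    derivative. Each power is integrated by the Beta integral and the sum is passed through the
    integral by dominated convergence, which delivers integrability as well. *)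
Lemma fractional_integral_series c gam q w x :
  entire_coef c -> 0 < gam -> 0 < q -> 0 < x ->
  let F s := (x - s) `^ (q - 1) * series_powR' c gam w s in
  leb.-integrable `]0, x[ (fun s => (F s)%:E) /\
  (fun n => \sum_(0 <= j < n) gam * pseries_diffs c j * w ^+ j.+1 *
     (x `^ (j.+1%:R * gam + q - 1) *
       (gammaf (j.+1%:R * gam) * gammaf q / gammaf (j.+1%:R * gam + q)))) @ \oo -->
  \int[leb]_(s in `]0, x[) F s.
Proof.
move=> ec gam0 q0 x0 F.
have ed := entire_coef_diffs ec.
pose a j := gam * pseries_diffs c j * w ^+ j.+1.
pose f n s := (\sum_(0 <= j < n) a j * convol (j.+1%:R * gam) q x s)%:E.
pose Fx s := if 0 < s < x then (F s)%:E else 0%E.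
have FE : (fun s => (F s)%:E) \_ `]0, x[ = Fx.
  by apply/funext => s; rewrite patchE mem_setE in_itv.
have jg0 j : 0 < j.+1%:R * gam by rewrite mulr_gt0.
have fE n s : 0 < s < x -> f n s =
    ((x - s) `^ (q - 1) * (pseries (pseries_diffs c) (w * s `^ gam) n *
        (w * (gam * s `^ (gam - 1)))))%:E.
  move=> /andP[s0 sx]; congr EFin; rewrite /pseries /series/=.
  rewrite mulr_suml mulr_sumr; apply: eq_bigr => j _.
  rewrite /a /convol !pospow_powR ?subr_gt0//.
  have -> : s `^ (j.+1%:R * gam - 1) = s `^ (gam - 1) * (s `^ gam) ^+ j.
    rewrite -powR_mulrn ?powR_ge0// -powRrM -powR_gt0D//; congr (_ `^ _).
    by rewrite -natr1; ring.
  rewrite exprMn exprS; ring.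
have f0 n s : ~~ (0 < s < x) -> f n s = 0%E.
  move=> sx; congr EFin; apply: big1_seq => j _.
  by rewrite convol_out ?mulr0.
have fF s : f ^~ s @ \oo --> Fx s.
  rewrite /Fx; case: ifPn => sx; last first.
    by under eq_fun do rewrite (f0 _ _ sx); exact: cvg_cst.
  under eq_fun do rewrite (fE _ _ sx).
  apply: cvg_EFin; first exact: nearW.
  rewrite /comp/=; apply: cvgMr; apply: cvgMl.
  exact: entire_coef_cvg.
have iterm j : leb.-integrable setT (fun s => (a j * convol (j.+1%:R * gam) q x s)%:E).
  exact: (integrableZl measurableT (a j) (integrable_convol (jg0 j) q0 x0)).
have If n : leb.-integrable setT (f n).
  have := @integrable_sum _ _ R leb setT measurableT _ (index_iota 0 n) xpredT
    (fun j s => (a j * convol (j.+1%:R * gam) q x s)%:E) (fun j _ => iterm j).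
  by under eq_fun do rewrite sumEFin.
(* On ]0, x[ the argument w s^gam is at most |w| x^gam in modulus, so C bounds the partial sums and
   the chain-rule constants; both singular powers remain in [convol gam q x]. *)
pose C := limn (pseries (pseries_diffs c) (`|w| * x `^ gam)) * (`|w| * gam).
have domf n s : (`|f n s| <= (C * convol gam q x s)%:E)%E.
  have [sx|sx] := boolP (0 < s < x); last first.
    by rewrite f0// abse0 convol_out ?mulr0.
  rewrite fE// abse_EFin lee_fin; move: sx => /andP[s0 sx].
  rewrite /convol !pospow_powR ?subr_gt0//.
  rewrite !normrM (ger0_norm (powR_ge0 (x - s) _)) (ger0_norm (powR_ge0 s (gam - 1))).
  rewrite (gtr0_norm gam0) [leRHS]mulrA [leRHS]mulrC ler_wpM2l ?powR_ge0//.
  rewrite /C !mulrA ler_wpM2r ?powR_ge0// ler_wpM2r ?(ltW gam0)// ler_wpM2r//.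
  apply: entire_partial_sum_le => //.
  rewrite normrM ler_wpM2l// ger0_norm ?powR_ge0//.
  by apply: ge0_ler_powR; rewrite ?nnegrE ?ltW.
have mFx : measurable_fun [set: R] Fx.
  apply: (emeasurable_fun_cvg f) => [n|s _]; last exact: fF.
  exact: measurable_int (If n).
have aeF : {ae leb, forall s : measurableTypeR R, setT s -> f ^~ s @ \oo --> Fx s}.
  by apply: aeW => s _; exact: fF.
have aeD : {ae leb, forall (s : measurableTypeR R) n, setT s ->
    (`|f n s| <= (C * convol gam q x s)%:E)%E}.
  by apply: aeW => s n _; exact: domf.
have [iFx _ cvgI] := @dominated_convergence _ _ R leb setT measurableT f Fx
   (fun s => (C * convol gam q x s)%:E) (fun n => measurable_int _ (If n)) mFx
   aeF (integrableZl measurableT C (integrable_convol gam0 q0 x0)) aeD.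
have iF : leb.-integrable `]0, x[ (fun s => (F s)%:E).
  have mI : measurable (`]0, x[%classic : set (measurableTypeR R)) by exact: measurable_itv.
  have h := (integrable_mkcond (mu := leb) (fun s => (F s)%:E) mI).2.
  by rewrite FE in h; exact: h iFx.
split => //.
have IF : (\int[leb]_s Fx s = (\int[leb]_(s in `]0, x[) F s)%:E)%E.
  rewrite /Rintegral fineK; first by rewrite [RHS]integral_mkcond FE.
  exact: integrable_fin_num.
have Ifn n : (\int[leb]_s f n s = (\sum_(0 <= j < n) a j *
     (x `^ (j.+1%:R * gam + q - 1) *
       (gammaf (j.+1%:R * gam) * gammaf q / gammaf (j.+1%:R * gam + q))))%:E)%E.
  transitivity (\int[leb]_s \sum_(0 <= j < n) (a j * convol (j.+1%:R * gam) q x s)%:E)%E.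
    by apply: eq_integral => s _; rewrite sumEFin.
  rewrite (integral_sum measurableT iterm) -sumEFin; apply: eq_bigr => j _.
  transitivity (\int[leb]_s ((a j)%:E * (convol (j.+1%:R * gam) q x s)%:E))%E.
    by apply: eq_integral => s _; rewrite EFinM.
  rewrite (integralZl measurableT (integrable_convol (jg0 j) q0 x0)).
  by rewrite (integral_convol (jg0 j) q0 x0) -EFinM.
rewrite IF in cvgI.
have /fine_cvgP[_] := cvgI.
by apply: cvg_trans; apply: near_eq_cvg; apply: nearW => n /=; rewrite Ifn.
Qed.

End caputo_of_series.

Section caputo_of_modes.
Context (R : realType).
Local Notation leb := (@lebesgue_measure R).
Implicit Types (h k : R -> R) (x s : R).

(** A derivative is local, so values at s <= 0 do not matter. This permits replacing the
    coefficients of a solution, prescribed for x >= 0 only, by their closed form. *)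
Lemma eq_caputo (alpha : R) h k x : 0 < x -> (forall s, 0 < s -> h s = k s) ->
  caputo alpha h x = caputo alpha k x.
Proof.
move=> x0 hk.
have d1 s : 0 < s -> derive1 h s = derive1 k s.
  move=> s0; rewrite !derive1E; apply: near_eq_derive => //.
  by near=> t; apply: hk; near: t; exact: lt_nbhsr.
rewrite /caputo; have [a1|a1] := eqVneq alpha 1; first exact: d1.
have eqI : \int[leb]_(s in `]0, x[) ((x - s) `^ (- alpha) * derive1 h s) =
    \int[leb]_(s in `]0, x[) ((x - s) `^ (- alpha) * derive1 k s).
  by apply: eq_Rintegral => s; rewrite inE/= in_itv/= => /andP[s0 _]; rewrite d1.
by rewrite /= eqI.
Unshelve. all: by end_near. Qed.

(* The regularity under which the Caputo derivative is a convergent integral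
   depending linearly on the function. *)
Definition caputo_regular (alpha : R) h h' :=
  [/\ forall s, 0 < s -> is_derive s 1 h (h' s),
      forall s, 0 < s -> {for s, continuous h'}
    & alpha != 1 -> forall x, 0 < x -> leb.-integrable `]0, x[
        (fun s => ((x - s) `^ (- alpha) * h' s)%:E)].

Lemma caputoE (alpha : R) h h' x : caputo_regular alpha h h' -> 0 < x ->
  caputo alpha h x = if alpha == 1 then h' x else
    (gammaf (1 - alpha))^-1 * \int[leb]_(s in `]0, x[) ((x - s) `^ (- alpha) * h' s).
Proof.
move=> [dh _ _] x0.
have d1 s : 0 < s -> derive1 h s = h' s.
  by move=> /dh sh; rewrite derive1E derive_val.
rewrite /caputo; have [a1|a1] := eqVneq alpha 1; first exact: d1.
have eqI : \int[leb]_(s in `]0, x[) ((x - s) `^ (- alpha) * derive1 h s) =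
    \int[leb]_(s in `]0, x[) ((x - s) `^ (- alpha) * h' s).
  by apply: eq_Rintegral => s; rewrite inE/= in_itv/= => /andP[s0 _]; rewrite d1.
by rewrite /= Gamma_gammaf eqI.
Qed.

Lemma caputo_regular_lin (alpha a b : R) h h' k k' :
  caputo_regular alpha h h' -> caputo_regular alpha k k' ->
  caputo_regular alpha (fun s => a * h s + b * k s) (fun s => a * h' s + b * k' s).
Proof.
move=> [dh ch ih] [dk ck ik]; split.
- move=> s s0; have hs := dh s s0; have ks := dk s s0.
  by apply: is_deriveD; apply: is_deriveZ.
- move=> s s0; apply: continuousD; apply: continuousM; try exact: cvg_cst.
  + exact: ch.
  + exact: ck.
- move=> a1 x x0.
  have mI : measurable (`]0, x[%classic : set (measurableTypeR R)) by exact: measurable_itv.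
  have := integrableD mI (integrableZl mI a (ih a1 x x0)) (integrableZl mI b (ik a1 x x0)).
  congr (_.-integrable _ _); apply/funext => s /=; rewrite -!EFinM -EFinD; congr EFin.
  ring.
Qed.

Lemma caputo_lin (alpha a b : R) h h' k k' x :
  caputo_regular alpha h h' -> caputo_regular alpha k k' -> 0 < x ->
  caputo alpha (fun s => a * h s + b * k s) x =
  a * caputo alpha h x + b * caputo alpha k x.
Proof.
move=> rh rk x0; have rhk := caputo_regular_lin a b rh rk.
rewrite (caputoE rhk x0) (caputoE rh x0) (caputoE rk x0).
case: ifPn => // a1; rewrite !(mulrCA _ (gammaf _)^-1) -mulrDr; congr (_ * _).
have [_ _ /(_ a1 x x0) ih] := rh; have [_ _ /(_ a1 x x0) ik] := rk.
have mI : measurable (`]0, x[%classic : set (measurableTypeR R)) by exact: measurable_itv.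
rewrite -(RintegralZl a mI ih) -(RintegralZl b mI ik) -(RintegralD mI).
- by apply: eq_Rintegral => s _; ring.
- exact: (integrableZl mI a ih).
- exact: (integrableZl mI b ik).
Qed.

Lemma caputo_regular_cst (alpha a : R) : caputo_regular alpha (cst a) (cst 0).
Proof.
split.
- by move=> s _; exact: is_derive_cst.
- by move=> s _; exact: cvg_cst.
- move=> _ x x0; rewrite (_ : (fun s => _) = cst 0%E); first exact: integrable0.
  by apply/funext => s /=; rewrite mulr0.
Qed.

Lemma caputo_cst (alpha a x : R) : 0 < x -> caputo alpha (cst a) x = 0.
Proof.
move=> x0; rewrite (caputoE (caputo_regular_cst alpha a) x0); case: ifPn => // _.
rewrite (_ : \int[leb]_(s in _) _ = 0) ?mulr0//.
by rewrite (_ : (fun s => _) = cst 0) ?/Rintegral ?integral0//; apply/funext => s /=; rewrite mulr0.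
Qed.

Context (alpha beta : R).
Hypothesis (alpha_gt0 : 0 < alpha) (alpha_le1 : alpha <= 1) (beta_ge0 : 0 <= beta).
Local Notation gam := (alpha + beta).

Definition ks_mode w := series_powR (ks_coef alpha beta) gam w.
Definition ks_mode' w := series_powR' (ks_coef alpha beta) gam w.

Lemma ks_modeE w x : ks_mode w x = ks alpha beta (w * x `^ gam).
Proof. by []. Qed.

Let ke := ks_entire alpha_gt0 beta_ge0.
Let gam0 := ks_gam_gt0 alpha_gt0 beta_ge0.

Lemma ks_mode_regular w : caputo_regular alpha (ks_mode w) (ks_mode' w).
Proof.
split.
- by move=> s s0; exact: is_derive_series_powR ke s0.
- by move=> s s0; exact: continuous_series_powR' ke s0.
- move=> a1 x x0; have q0 : 0 < 1 - alpha by rewrite subr_gt0 lt_neqAle a1.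
  have [] := fractional_integral_series w ke gam0 q0 x0.
  by rewrite (_ : 1 - alpha - 1 = - alpha)//; ring.
Qed.

(** With t = (j + 1) gam, the Gamma arguments of [ks_ratio j] are t + 1 - alpha and t + 1, and Gamma
    (t + 1) = t Gamma t. It is the identity by which differentiating the term j + 1 reproduces the
    term j. *)
Lemma ks_coef_Gamma j : ks_coef alpha beta j.+1 * (j.+1%:R * gam) *
    gammaf (j.+1%:R * gam) =
  ks_coef alpha beta j * gammaf (j.+1%:R * gam + (1 - alpha)).
Proof.
have t0 : 0 < j.+1%:R * gam by rewrite mulr_gt0.
rewrite (ks_coefS beta alpha_gt0) /ks_ratio.
have -> : j%:R * gam + (beta + 1) + alpha = j.+1%:R * gam + 1 by rewrite -natr1; ring.
have -> : j%:R * gam + (beta + 1) = j.+1%:R * gam + (1 - alpha) by rewrite -natr1; ring.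
rewrite (gammafS t0); have /gt_eqF := gammaf_gt0 t0; move: t0 => /gt_eqF.
move: (j.+1%:R * gam) => t t0.
move: (gammaf t) (gammaf (t + _)) (ks_coef _ _ _) => u v w u0.
by field; rewrite t0 u0.
Qed.

Lemma caputo_ks_mode w x : 0 < x ->
  caputo alpha (ks_mode w) x = w * x `^ beta * ks_mode w x.
Proof.
move=> x0; rewrite (caputoE (ks_mode_regular w) x0); case: ifPn => [/eqP a1|a1].
  have b1 : alpha + beta - 1 = beta by rewrite a1; ring.
  rewrite /ks_mode' /series_powR' b1 /ks_mode /series_powR.
  set z := w * x `^ (alpha + beta).
  have -> : limn (pseries (ks_coef alpha beta) z) =
      gam * limn (pseries (pseries_diffs (ks_coef alpha beta)) z).
    apply/cvg_lim => //.
    rewrite (_ : pseries (ks_coef alpha beta) z =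
      (fun n => gam * pseries (pseries_diffs (ks_coef alpha beta)) z n)).
      by apply: cvgMr; apply: entire_coef_cvg; exact: entire_coef_diffs.
    apply/funext => n; rewrite /pseries /series/= mulr_sumr; apply: eq_bigr => j _.
    rewrite mulrA; congr (_ * _); rewrite /pseries_diffs.
    have t0 : 0 < j.+1%:R * gam by rewrite mulr_gt0.
    (* At alpha = 1 both Gamma values in this identity have the same argument and cancel. *)
    have := ks_coef_Gamma j; rewrite (_ : 1 - alpha = 0) ?addr0; last by rewrite a1 subrr.
    move=> e0; have -> : ks_coef alpha beta j = ks_coef alpha beta j.+1 * (j.+1%:R * gam).
      by apply: (mulIf (lt0r_neq0 (gammaf_gt0 t0))); rewrite e0.
    ring.
  ring.
have q0 : 0 < 1 - alpha by rewrite subr_gt0 lt_neqAle a1.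
have /gt_eqF/negbT Gq := gammaf_gt0 q0.
have [_] := fractional_integral_series w ke gam0 q0 x0.
rewrite (_ : 1 - alpha - 1 = - alpha); last by ring.
move=> /cvg_lim <- //.
apply: (mulfI Gq); rewrite mulrA divff// mul1r.
apply/cvg_lim => //.
have cvgR : (fun n => gammaf (1 - alpha) * (w * x `^ beta) *
     pseries (ks_coef alpha beta) (w * x `^ gam) n) @ \oo -->
   gammaf (1 - alpha) * (w * x `^ beta * ks_mode w x).
  by rewrite [X in _ --> X]mulrA; apply: cvgMr; exact: entire_coef_cvg.
apply: cvg_trans cvgR; apply: near_eq_cvg; apply: nearW => n.
rewrite /pseries /series/= mulr_sumr; apply: eq_bigr => j _.
have t0 : 0 < j.+1%:R * gam by rewrite mulr_gt0.
(* The derivative lowers the exponent (j + 1) gam by alpha, which leaves j gam + beta. *)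
have -> : x `^ (j.+1%:R * gam + (1 - alpha) - 1) = x `^ beta * (x `^ gam) ^+ j.
  rewrite -powR_mulrn ?powR_ge0// -powRrM -powR_gt0D//; congr (_ `^ _).
  by rewrite -natr1; ring.
have t1 : 0 < j.+1%:R * gam + (1 - alpha) by rewrite addr_gt0.
have := ks_coef_Gamma j; rewrite /pseries_diffs.
have /gt_eqF := gammaf_gt0 t1.
move: (gammaf (1 - alpha)) (gammaf (j.+1%:R * gam)) (gammaf _) => a b c c0 e.
rewrite exprS exprMn.
have -> : gam * (j.+1%:R * ks_coef alpha beta j.+1) * (w * w ^+ j) *
  (x `^ beta * (x `^ gam) ^+ j * (b * a / c)) =
  ks_coef alpha beta j.+1 * (j.+1%:R * gam) * b * a / c * w * w ^+ j * x `^ beta * (x `^ gam) ^+ j.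
  by ring.
by rewrite e; field; rewrite c0.
Qed.

End caputo_of_modes.

(** * Comparison principle for the Caputo derivative *)

Section minimum_principle.
Context (R : realType).
Local Notation leb := (@lebesgue_measure R).
Implicit Types (h : R -> R) (x s : R).

(** The mean value theorem to the left of x. The two controls on the slope serve the two cases of
    [caputo_min]: its sign for alpha = 1, its size for alpha < 1. *)
Lemma le_increment_left h h' x : 0 < x ->
  (forall s, 0 < s -> is_derive s 1 h (h' s)) -> {for x, continuous h'} ->
  exists2 e : R, 0 < e < x & forall t : R, 0 < t <= e ->
    exists2 c, `|h' c - h' x| < 1 /\ (h' x > 0 -> h' c > 0) & h x - h (x - t) = h' c * t.
Proof.
(* Staying within h' x of h' x keeps h' c positive; when h' x <= 0 there is no sign to keep and 1 is
   a default. *)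
move=> x0 dh ch; pose m := Num.min 1 (if 0 < h' x then h' x else 1).
have m0 : 0 < m by rewrite lt_min ltr01/=; case: ifP.
have /cvgrPdist_lt/(_ _ m0) [r /= r0 hr] := ch.
pose e := Num.min (r / 2) (x / 2).
have e0 : 0 < e by rewrite lt_min !divr_gt0.
have ex : e < x.
  by rewrite (@le_lt_trans _ _ (x / 2)) ?ge_min ?lexx ?orbT// ltr_pdivrMr// ltr_pMr// ltr1n.
have er : e < r.
  by rewrite (@le_lt_trans _ _ (r / 2)) ?ge_min ?lexx// ltr_pdivrMr// ltr_pMr// ltr1n.
exists e; first by rewrite e0.
move=> t /andP[t0 te]; have xt0 : 0 < x - t by rewrite subr_gt0 (le_lt_trans te).
have [|||c] := @MVT R h h' (x - t) x.
- by rewrite ltrBlDr ltrDl.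
- by move=> s; rewrite in_itv/= => /andP[s0 _]; apply: dh; exact: lt_trans s0.
- apply: continuous_in_subspaceT => s; rewrite inE/= in_itv/= => /andP[s0 _].
  have [hs _] := dh s (lt_le_trans xt0 s0).
  apply: differentiable_continuous; exact/derivable1_diffP.
rewrite in_itv/= => /andP[c1 c2] hc.
have := hr c; rewrite /ball/= gtr0_norm ?subr_gt0// => hcx.
have {}hcx : `|h' x - h' c| < m.
  apply: hcx; rewrite (lt_trans _ er)// (lt_le_trans _ te)//.
  by rewrite ltrBlDr addrC -ltrBlDr.
exists c; last by rewrite hc opprB addrCA subrr addr0.
split; first by rewrite distrC (lt_le_trans hcx)// ge_min lexx.
move=> hx0; move: hcx; rewrite /m hx0 lt_min => /andP[_].
by rewrite ltr_norml => /andP[_]; rewrite ltrBlDr ltrDl.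
Qed.

(** For alpha = 1, a positive derivative at x would give smaller values just before x. For alpha <
    1, a comparison on [d, x - d] leaves a boundary term O(d^(1-alpha)) at x - d and a term of
    favourable sign at d. Both ends are cut: h' may be singular at 0, the kernel is singular at
    x. *)
Lemma caputo_min (alpha : R) h h' x :
  0 < alpha -> alpha <= 1 -> caputo_regular alpha h h' -> 0 < x ->
  (forall s, 0 < s <= x -> h x <= h s) -> caputo alpha h x <= 0.
Proof.
move=> alpha_gt0 alpha_le1 rh x0 hmin; rewrite (caputoE rh x0).
have [dh ch ih] := rh.
have [e /andP[e0 ex] he] := le_increment_left x0 dh (ch _ x0).
case: ifPn => a1.
  rewrite leNgt; apply/negP => h'0.
  have [|c [_ /(_ h'0) c0] hc] := he e; first by rewrite e0 lexx.
  have := hmin (x - e); rewrite subr_gt0 ex gerBl (ltW e0) => /(_ erefl).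
  by rewrite -subr_le0 hc leNgt mulr_gt0.
have alpha_lt1 : alpha < 1 by rewrite lt_neqAle a1.
rewrite pmulr_rle0; last by rewrite invr_gt0 gammaf_gt0// subr_gt0.
have iG := ih a1 x x0.
pose G s := (x - s) `^ (- alpha) * h' s.
(* With [n.+3] one has d n < x / 2, so every truncated interval is nondegenerate. *)
pose d (n : nat) : R := x / n.+3%:R.
have d0 n : 0 < d n by rewrite divr_gt0.
have dx n : d n < x - d n.
  rewrite ltrBrDr /d -mulrDl ltr_pdivrMr// -mulr2n -[x *+ 2]mulr_natr ltr_pM2l//.
  by rewrite ltr_nat.
pose F (n : nat) : set (measurableTypeR R) := `[d n, x - d n]%classic.
have mF n : measurable (F n) by exact: measurable_itv.
have Fsub n : F n `<=` `]0, x[.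
  move=> s; rewrite /F/= !in_itv/= => /andP[s1 s2].
  by rewrite (lt_le_trans (d0 n) s1) (le_lt_trans s2)// ltrBlDr ltrDl.
have dcvg : d n @[n --> \oo] --> (0 : R).
  rewrite -[X in _ --> X](mulr0 x); apply: cvgMr.
  have := @cvg_harmonic R; rewrite -(@cvg_shiftS R) -(@cvg_shiftS R).
  exact.
(* As h s >= h x, the integrand G is at most the derivative Psi' of
   Psi s = (x - s) ^ -alpha * (h s - h x), which vanishes as s tends to x. *)
pose Psi' s := (x - s) `^ (- alpha) * h' s +
   (alpha * (x - s) `^ (- alpha - 1)) * (h s - h x).
pose Psi s := (x - s) `^ (- alpha) * (h s - h x).
have dPsi s : 0 < s < x -> is_derive s 1 Psi (Psi' s).
  move=> /andP[s0 sx]; have xs0 : 0 < x - s by rewrite subr_gt0.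
  have d1 : is_derive s 1 (fun s => x - s) (-1 : R).
    have h0 : is_derive s 1 (cst x - id : R -> R) (0 - 1) := is_deriveB (is_derive_cst x s 1) (is_derive_id s 1).
    by rewrite sub0r in h0.
  have d2 := @is_derive1_comp R (fun u => u `^ (- alpha)) (fun s => x - s) s _ _
    (is_derive1_powR (- alpha) xs0) d1.
  have d3 : is_derive s 1 (fun s => h s - h x) (h' s).
    have h0 : is_derive s 1 (h - cst (h x) : R -> R) (h' s - 0) :=
      is_deriveB (dh s s0) (is_derive_cst (h x) s 1).
    by rewrite subr0 in h0.
  have d4 : is_derive s 1 Psi _ := is_deriveM d2 d3.
  apply: (is_derive_eq d4).
  by rewrite /Psi' /GRing.scale/=; ring.
have cp (p s : R) : 0 < s < x -> {for s, continuous (fun s => (x - s) `^ p)}.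
  move=> /andP[s0 sx]; apply: (@continuous_comp _ _ _ (fun s => x - s) (fun u : R => u `^ p)).
    by apply: continuousB; [exact: cvg_cst|exact: cvg_id].
  by apply: continuous_powR_gt0; rewrite subr_gt0.
have chh s : 0 < s -> {for s, continuous h}.
  move=> /dh [hs _]; apply: differentiable_continuous; exact/derivable1_diffP.
have cPsi' s : 0 < s < x -> {for s, continuous Psi'}.
  move=> sx; have /andP[s0 _] := sx.
  apply: continuousD; apply: continuousM.
  - exact: cp.
  - exact: ch.
  - by apply: continuousM; [exact: cvg_cst|exact: cp].
  - by apply: continuousB; [exact: chh|exact: cvg_cst].
have IPsi n : (\int[leb]_(s in F n) (Psi' s)%:E = (Psi (x - d n) - Psi (d n))%:E)%E.
  by apply: (integral_derive_itv (d0 n) (dx n) _ dPsi cPsi'); rewrite ltrBlDr ltrDl.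
have iPsi n : leb.-integrable (F n) (EFin \o Psi').
  apply: continuous_compact_integrable; first exact: segment_compact.
  by apply: continuous_in_subspaceT => s; rewrite inE => /Fsub/=; rewrite in_itv/= => /cPsi'.
have iGn n : leb.-integrable (F n) (EFin \o G).
  have mI : measurable (`]0, x[%classic : set (measurableTypeR R)) by exact: measurable_itv.
  exact: (integrableS mI (mF n) (Fsub n) iG).
have hge s : 0 < s < x -> 0 <= h s - h x.
  by move=> /andP[s0 sx]; rewrite subr_ge0 hmin// s0 ltW.
have le1 n : \int[leb]_(s in F n) G s <= Psi (x - d n) - Psi (d n).
  rewrite (_ : Psi _ - _ = \int[leb]_(s in F n) Psi' s); last by rewrite /Rintegral IPsi.
  apply: le_Rintegral => // s /Fsub/=; rewrite in_itv/= => sx.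
  by rewrite lerDl mulr_ge0 ?hge// mulr_ge0 ?powR_ge0 ?ltW.
(* Slopes near x are bounded by M, so Psi (x - d n) is at most d^(-alpha) * M * d with d = d n. *)
pose M := `|h' x| + 1.
have le2 : \forall n \near \oo, \int[leb]_(s in F n) G s <= M * (d n) `^ (1 - alpha).
  have /cvgrPdist_le/(_ _ e0) := dcvg; apply: filterS => n.
  rewrite sub0r normrN gtr0_norm// => dne.
  apply: (le_trans (le1 n)).
  apply: (@le_trans _ _ (Psi (x - d n))).
    rewrite gerBl mulr_ge0 ?powR_ge0 ?hge// d0/= (lt_trans (dx n))//.
    by rewrite ltrBlDr ltrDl.
  have [|c [hc _] hxc] := he (d n); first by rewrite d0.
  rewrite /Psi (_ : x - (x - d n) = d n); last by ring.
  rewrite (_ : h (x - d n) - h x = - (h' c * d n)); last by rewrite -hxc opprB.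
  rewrite powR_gt0D// powRr1 ?(ltW (d0 n))// [leRHS]mulrA [leLHS]mulrC ler_wpM2r ?powR_ge0//.
  rewrite -mulNr ler_wpM2r ?(ltW (d0 n))//.
  apply: le_trans (ler_norm _) _; rewrite normrN -(subrK (h' x) (h' c)) addrC.
  by apply: le_trans (ler_normD _ _) _; rewrite lerD2l ltW.
have mI : measurable (`]0, x[%classic : set (measurableTypeR R)) by exact: measurable_itv.
have cvgI : \int[leb]_(s in F n) G s @[n --> \oo] --> \int[leb]_(s in `]0, x[) G s.
  pose GI := (EFin \o G) \_ `]0, x[.
  have iGI : leb.-integrable setT GI by exact: (integrable_mkcond _ mI).1 iG.
  have GFE n : (EFin \o G) \_ (F n) = GI \_ (F n).
    apply/funext => s; rewrite /GI !patchE; case: ifPn => //; rewrite inE => /Fsub sI.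
    by rewrite mem_set.
  have mGn n : measurable_fun setT ((EFin \o G) \_ (F n)).
    exact: measurable_int ((integrable_mkcond _ (mF n)).1 (iGn n)).
  have aeF : {ae leb, forall s : measurableTypeR R, setT s ->
      (fun n => ((EFin \o G) \_ (F n)) s) @ \oo --> GI s}.
    apply: aeW => s _; have [sI|sI] := boolP (0 < s < x); last first.
      rewrite (_ : (fun n => _) = cst (GI s)); first exact: cvg_cst.
      apply/funext => n; rewrite GFE patchE; case: ifPn => // _.
      by rewrite /GI patchE mem_setE in_itv/= (negbTE sI).
    apply: cvg_near_cst; have /andP[s0 sx] := sI.
    have m0 : 0 < Num.min s (x - s) by rewrite lt_min s0 subr_gt0.
    have /cvgrPdist_le/(_ _ m0) := dcvg; apply: filterS => n.
    rewrite sub0r normrN gtr0_norm// le_min => /andP[ns nx].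
    rewrite GFE patchE ifT//; apply/mem_set; rewrite /F/= in_itv/= ns/=.
    by rewrite lerBrDl -lerBrDr.
  have aeD : {ae leb, forall (s : measurableTypeR R) n, setT s ->
      (`|((EFin \o G) \_ (F n)) s| <= (abse \o GI) s)%E}.
    apply: aeW => s n _; rewrite GFE patchE; case: ifPn => //= _.
    by rewrite normr0 abse_ge0.
  have [_ _] := @dominated_convergence _ _ R leb setT measurableT _ GI _ mGn
    (measurable_int _ iGI) aeF (integrable_abse iGI) aeD.
  have -> : (\int[leb]_s GI s = (\int[leb]_(s in `]0, x[) G s)%:E)%E.
    by rewrite /Rintegral fineK ?integrable_fin_num// [RHS]integral_mkcond.
  move/fine_cvgP => [_]; apply: cvg_trans; apply: near_eq_cvg; apply: nearW => n /=.
  by rewrite -integral_mkcond.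
apply: (ler_cvg_to cvgI _ le2).
rewrite -(mulr0 M); apply: cvgMr.
have a10 : 0 < 1 - alpha by rewrite subr_gt0.
by have /cvg_at_rightP := powR_cvg0 a10; apply.
Qed.

End minimum_principle.

(** * Bounds, monotonicity and limit of the Kilbas-Saigo function on the negative axis *)

Section kilbas_saigo_bounds.
Context (R : realType) (alpha beta : R).
Hypothesis (alpha_gt0 : 0 < alpha) (alpha_le1 : alpha <= 1) (beta_ge0 : 0 <= beta).
Local Notation gam := (alpha + beta).
Implicit Types (h : R -> R) (x s mu z : R).

(** Right continuity at 0 provides a minimum point on the closed interval [0, x], and h 0 >= 0 keeps
    a negative minimum away from 0, where [caputo_min] would not apply. *)
Lemma caputo_comparison h h' mu : 0 < mu -> caputo_regular alpha h h' ->
  h x @[x --> 0^'+] --> h 0 -> 0 <= h 0 ->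
  (forall x, 0 < x -> - (mu * x `^ beta * h x) <= caputo alpha h x) ->
  forall x, 0 <= x -> 0 <= h x.
Proof.
move=> mu0 rh h0r h00 hD x; rewrite le_eqVlt => /predU1P[<-//|x0].
rewrite leNgt; apply/negP => hx0.
have [dh _ _] := rh.
have ch s : 0 < s -> {for s, continuous h}.
  by move=> /dh [hs _]; apply: differentiable_continuous; exact/derivable1_diffP.
have hcont : {within `[0, x], continuous h}.
  apply: derivable_oo_LRcontinuous_within; split => //.
  - by move=> s; rewrite in_itv/= => /andP[/dh[]].
  - by apply: cvg_at_left_filter; exact: ch.
have [c] := EVT_min (ltW x0) hcont.
rewrite in_itv/= => /andP[c0 cx] hc.
have hc0 : h c < 0.
  by apply: le_lt_trans hx0; apply: hc; rewrite in_itv/= lexx ltW.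
have {}c0 : 0 < c.
  rewrite lt_neqAle c0 andbT; apply/eqP => e; move: hc0; rewrite -e ltNge.
  by rewrite h00.
have := caputo_min alpha_gt0 alpha_le1 rh c0.
have hmin s : 0 < s <= c -> h c <= h s.
  by move=> /andP[s0 sc]; apply: hc; rewrite in_itv/= (ltW s0) (le_trans sc).
move=> /(_ hmin); rewrite leNgt => /negP; apply.
apply: (lt_le_trans _ (hD c c0)).
by rewrite -mulrN mulr_gt0 ?oppr_gt0// mulr_gt0// powR_gt0.
Qed.

Let ke := ks_entire alpha_gt0 beta_ge0.
Let gam0 := ks_gam_gt0 alpha_gt0 beta_ge0.

Lemma ks0 : ks alpha beta 0 = 1.
Proof.
have := ks_second alpha_gt0 beta_ge0 0; rewrite mulr0 mul0r.
by move/eqP; rewrite eq_sym subr_eq0 => /eqP.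
Qed.

Lemma ks_mode0 w : ks_mode alpha beta w 0 = 1.
Proof. by rewrite ks_modeE powR0 ?gt_eqF// mulr0 ks0. Qed.

Lemma ks_mode_right0 w : ks_mode alpha beta w x @[x --> 0^'+] --> ks_mode alpha beta w 0.
Proof.
rewrite ks_mode0 -ks0.
have h : w * x `^ gam @[x --> 0^'+] --> (0 : R).
  by rewrite -[X in _ --> X](mulr0 w); apply: cvgMr; exact: powR_cvg0.
have c0 : ks alpha beta z @[z --> 0] --> ks alpha beta 0 := @continuous_entire R _ ke 0.
exact: (cvg_comp _ _ h c0).
Qed.

Lemma ks_modeN_ge0 mu x : 0 < mu -> 0 <= x -> 0 <= ks_mode alpha beta (- mu) x.
Proof.
move=> mu0; apply: (caputo_comparison mu0 (ks_mode_regular alpha_gt0 alpha_le1 beta_ge0 _)).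
- exact: ks_mode_right0.
- by rewrite ks_mode0.
- by move=> s s0; rewrite (caputo_ks_mode alpha_gt0 alpha_le1 beta_ge0 _ s0) !mulNr.
Qed.

(** For h = 1 - v the Caputo derivative is mu x^beta v = mu x^beta - mu x^beta h, which is at least
    - mu x^beta h. *)
Lemma ks_modeN_le1 mu x : 0 < mu -> 0 <= x -> ks_mode alpha beta (- mu) x <= 1.
Proof.
move=> mu0 x0; rewrite -subr_ge0.
have rm := ks_mode_regular alpha_gt0 alpha_le1 beta_ge0 (- mu).
have rc := caputo_regular_cst alpha (1 : R).
suff: 0 <= -1 * ks_mode alpha beta (- mu) x + 1 * cst 1 x.
  by rewrite mulN1r mul1r addrC /= => h; exact: h.
move: x x0; apply: (caputo_comparison mu0 (caputo_regular_lin (-1) 1 rm rc)).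
- apply: cvgD; apply: cvgMr; first exact: ks_mode_right0.
  exact: cvg_cst.
- by rewrite ks_mode0 /= mulN1r mul1r addrC subrr.
- move=> s s0; rewrite (caputo_lin _ _ rm rc s0) (caputo_cst _ _ s0) mulr0 addr0.
  rewrite (caputo_ks_mode alpha_gt0 alpha_le1 beta_ge0 _ s0) /=.
  have : 0 <= mu * s `^ beta by rewrite mulr_ge0 ?powR_ge0 ?ltW.
  move: (ks_mode _ _ _ _) => v; move: (mu * _) (mulNr mu (s `^ beta)) => t -> t0.
  by rewrite !mulN1r !mulNr opprK mulr1 mulrDr mulrN opprD opprK mulr1 gerBl.
Qed.

(** For h = v_mu - v_mu' the Caputo derivative is x^beta ((mu' - mu) v_mu - mu' h); the first term
    is nonnegative, so comparison applies with the larger rate mu'. *)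
Lemma ks_modeN_anti mu mu' x : 0 < mu -> mu <= mu' -> 0 <= x ->
  ks_mode alpha beta (- mu') x <= ks_mode alpha beta (- mu) x.
Proof.
move=> mu0 mumu' x0; have mu'0 : 0 < mu' by exact: lt_le_trans mumu'.
rewrite -subr_ge0.
have rm := ks_mode_regular alpha_gt0 alpha_le1 beta_ge0 (- mu).
have rm' := ks_mode_regular alpha_gt0 alpha_le1 beta_ge0 (- mu').
suff: 0 <= 1 * ks_mode alpha beta (- mu) x + -1 * ks_mode alpha beta (- mu') x.
  by rewrite mulN1r mul1r.
move: x x0; apply: (caputo_comparison mu'0 (caputo_regular_lin 1 (-1) rm rm')).
- by apply: cvgD; apply: cvgMr; exact: ks_mode_right0.
- by rewrite !ks_mode0 mulN1r mul1r subrr.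
- move=> s s0; rewrite (caputo_lin _ _ rm rm' s0).
  rewrite !(caputo_ks_mode alpha_gt0 alpha_le1 beta_ge0 _ s0) /=.
  have : 0 <= (mu' - mu) * s `^ beta * ks_mode alpha beta (- mu) s.
    by rewrite !mulr_ge0 ?powR_ge0 ?subr_ge0// ks_modeN_ge0// ltW.
  move: (ks_mode _ _ _ _) (ks_mode _ _ _ _) (s `^ beta) => u v t; lra.
Qed.

(** Varying the rate at the fixed point x = 1 already reaches every negative argument. *)
Lemma ksN_mode z : ks alpha beta (- z) = ks_mode alpha beta (- z) 1.
Proof. by rewrite ks_modeE powR1 mulr1. Qed.

Lemma ksN_ge0 z : 0 <= z -> 0 <= ks alpha beta (- z).
Proof.
rewrite le_eqVlt => /predU1P[<-|z0]; first by rewrite oppr0 ks0.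
by rewrite ksN_mode ks_modeN_ge0.
Qed.

Lemma ksN_le1 z : 0 <= z -> ks alpha beta (- z) <= 1.
Proof.
rewrite le_eqVlt => /predU1P[<-|z0]; first by rewrite oppr0 ks0.
by rewrite ksN_mode ks_modeN_le1.
Qed.

Lemma ksN_anti z z' : 0 <= z -> z <= z' -> ks alpha beta (- z') <= ks alpha beta (- z).
Proof.
rewrite le_eqVlt => /predU1P[<-|z0] zz'; first by rewrite oppr0 ks0 ksN_le1.
by rewrite !ksN_mode ks_modeN_anti.
Qed.

Lemma ksN_cvg : exists2 l : R, ks alpha beta (- z) @[z --> +oo] --> l &
  forall z, 0 <= z -> l <= ks alpha beta (- z).
Proof.
(* Clipping at 0 and changing sign produces a bounded nondecreasing function on the whole line,
   whose limit is its supremum. *)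
pose f z : R := - ks alpha beta (- Num.max z 0).
have ndf : nondecreasing_fun f.
  move=> z z' zz'; rewrite /f lerN2; apply: ksN_anti.
    by rewrite le_max lexx orbT.
  by rewrite ge_max !le_max zz' lexx orbT.
have ubf : has_ubound (range f).
  by exists 0 => _ [z _ <-]; rewrite /f oppr_le0 ksN_ge0// le_max lexx orbT.
have fE z : 0 <= z -> f z = - ks alpha beta (- z) by move=> z0; rewrite /f max_l.
exists (- sup (range f)).
  apply/cvgNP; rewrite opprK; apply: cvg_trans (nondecreasing_cvgr ndf ubf).
  apply: near_eq_cvg; apply: filterS (nbhs_pinfty_ge (num_real (0 : R))) => z z0 /=.
  by rewrite fE.
move=> z z0; rewrite lerNl -fE//; exact: ub_le_sup.
Qed.

End kilbas_saigo_bounds.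

(** * Square integrable functions and orthonormal series *)

Lemma geometric_increments_cvg (R : realType) (u : R^nat) (C : R) :
  (forall i, `|u i.+1 - u i| <= C / 2 ^+ i) ->
  cvgn u /\ forall j, `|limn u - u j| <= 2 * C / 2 ^+ j.
Proof.
move=> du.
have C0 : 0 <= C by have := du 0%N; rewrite expr0 divr1; exact: le_trans.
have p0 i : 0 < (2 ^+ i)^-1 :> R by rewrite invr_gt0 exprn_gt0.
(* Keeping the exact geometric remainder makes the induction on k close. *)
have tele j k : `|u (j + k)%N - u j| <= 2 * C / 2 ^+ j - 2 * C / 2 ^+ (j + k).
  elim: k => [|k ih]; first by rewrite addn0 !subrr normr0.
  rewrite addnS (_ : _ - u j = (u (j + k).+1 - u (j + k)%N) + (u (j + k)%N - u j)); last by ring.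
  apply: le_trans (ler_normD _ _) _; apply: le_trans (lerD (du _) ih) _.
  rewrite exprS invfM; move: (2 ^+ (j + k))^-1 => w; lra.
have tele' j m : (j <= m)%N -> `|u m - u j| <= 2 * C / 2 ^+ j.
  move=> jm; have := tele j (m - j)%N; rewrite subnKC//.
  move=> h; apply: le_trans h _; rewrite gerBl.
  by rewrite mulr_ge0 ?(ltW (p0 _))// mulr_ge0.
have ucvg : cvgn u.
  apply: cauchy_cvg; apply/cauchy_ballP => e e0; rewrite near_simpl.
  have : (2 * (2 * C)) * (2^-1) ^+ n @[n --> \oo] --> (0 : R).
    rewrite -[X in _ --> X](mulr0 (2 * (2 * C))); apply: cvgMr; apply: cvg_expr.
    by rewrite gtr0_norm// invf_lt1// ltr1n.
  move=> /cvgrPdist_lt/(_ _ e0) [N _ HN].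
  exists ([set n | (N <= n)%N], [set n | (N <= n)%N]); first by split; exists N.
  move=> [n m] [/= Nn Nm]; rewrite /ball/=.
  rewrite (_ : u n - u m = (u n - u N) - (u m - u N)); last by ring.
  apply: le_lt_trans (ler_normB _ _) _; apply: le_lt_trans (lerD (tele' _ _ Nn) (tele' _ _ Nm)) _.
  have := HN N (leqnn N); rewrite sub0r normrN; apply: le_lt_trans.
  apply: le_trans (ler_norm _); rewrite exprVn; move: (2 ^+ N)^-1 => w; lra.
split => // j.
have h : `|u m - u j| @[m --> \oo] --> `|limn u - u j|.
  by apply: cvg_norm; apply: cvgB; [exact: ucvg|exact: cvg_cst].
apply: (ler_cvg_to h (cvg_cst (2 * C / 2 ^+ j))).
by exists j => // m /= jm; exact: tele'.
Qed.

Section square_integrable.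
Context d (T : measurableType d) (R : realType) (mu : {measure set T -> \bar R}).
Implicit Types (f g : T -> R).

Definition sqint f : \bar R := (\int[mu]_x ((f x) ^+ 2)%:E)%E.

Definition square_integrable f := measurable_fun setT f /\ (sqint f < +oo)%E.

Lemma measurable_sqr f : measurable_fun setT f ->
  measurable_fun setT (fun x => ((f x) ^+ 2)%:E).
Proof. by move=> mf; apply/measurable_EFinP; exact: measurable_funX. Qed.

Lemma sqint_ge0 f : (0 <= sqint f)%E.
Proof. by apply: integral_ge0 => x _; rewrite lee_fin sqr_ge0. Qed.

Lemma Lnorm2E f : ('N[mu]_2%:E[EFin \o f] = (sqint f) `^ 2^-1)%E.
Proof.
rewrite unlock; congr (_ `^ _)%E; apply: eq_integral => x _ /=.
by rewrite powR_mulrn// real_normK// num_real.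
Qed.

Lemma Lfun2P f : f \in Lfun mu 2%:E <-> square_integrable f.
Proof.
split.
  move=> f2; have := Lfun2_integrable_sqr f2; move: f2; rewrite inE => /andP[mf _].
  rewrite inE/= in mf => /integrableP[_ sf]; split=> //.
  move: sf; apply: le_lt_trans; rewrite /sqint le_eqVlt; apply/orP; left; apply/eqP.
  by apply: eq_integral => x _; rewrite /= ger0_norm ?sqr_ge0.
move=> [mf sf]; rewrite inE; apply/andP; split; first by rewrite inE.
by rewrite inE/= /finite_norm Lnorm2E poweR_lty.
Qed.

Lemma sqint_fin f : square_integrable f -> sqint f = (fine (sqint f))%:E.
Proof. by move=> [_ sf]; rewrite fineK// ge0_fin_numE ?sqint_ge0. Qed.

Lemma Lnorm2_sqrt f : square_integrable f ->
  'N[mu]_2%:E[EFin \o f]%E = (Num.sqrt (fine (sqint f)))%:E.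
Proof.
move=> f2; rewrite Lnorm2E (sqint_fin f2) poweR_EFin powR12_sqrt//.
by rewrite fine_ge0 ?sqint_ge0.
Qed.

Lemma measurable_lin (a b : R) f g :
  measurable_fun setT f -> measurable_fun setT g ->
  measurable_fun setT (fun x => a * f x + b * g x).
Proof.
by move=> mf mg; apply: measurable_funD; apply: measurable_funM => //; exact: measurable_cst.
Qed.

(** Pointwise (p + q)^2 <= 2 p^2 + 2 q^2, because (p - q)^2 >= 0; this stands in for the triangle
    inequality. *)
Lemma sqint_lin_le (a b : R) f g :
  measurable_fun setT f -> measurable_fun setT g ->
  (sqint (fun x => a * f x + b * g x)%R <=
   (2 * a ^+ 2)%:E * sqint f + (2 * b ^+ 2)%:E * sqint g)%E.
Proof.
move=> mf mg; have mh := measurable_lin a b mf mg.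
have k0 (c : R) : (0 <= (2 * c ^+ 2)%:E)%E by rewrite lee_fin mulr_ge0// sqr_ge0.
have q0 (k : T -> R) x : (0 <= (k x ^+ 2)%:E)%E by rewrite lee_fin sqr_ge0.
rewrite /sqint -!ge0_integralZl//; [|exact: measurable_sqr..].
rewrite -ge0_integralD//; last 4 first.
- by move=> x _; rewrite mule_ge0.
- by apply: measurable_funeM; exact: measurable_sqr.
- by move=> x _; rewrite mule_ge0.
- by apply: measurable_funeM; exact: measurable_sqr.
apply: ge0_le_integral => //.
- by move=> x _; rewrite lee_fin sqr_ge0.
- exact: measurable_sqr.
- by apply: emeasurable_funD; apply: measurable_funeM; exact: measurable_sqr.
- move=> x _; rewrite -!EFinM -EFinD lee_fin -subr_ge0.
  by have := sqr_ge0 (a * f x - b * g x); rewrite !expr2; lra.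
Qed.

Lemma square_integrable_lin (a b : R) f g :
  square_integrable f -> square_integrable g ->
  square_integrable (fun x => a * f x + b * g x).
Proof.
move=> [mf sf] [mg sg]; split; first exact: measurable_lin.
apply: le_lt_trans (sqint_lin_le a b mf mg) _.
by rewrite lte_add_pinfty// lte_mul_pinfty// lee_fin mulr_ge0// sqr_ge0.
Qed.

End square_integrable.

Section completeness.
Context d (T : measurableType d) (R : realType) (mu : {measure set T -> \bar R}).
Implicit Types (f g h : T -> R).

(* Along a subsequence whose increments D j satisfy int (D j)^2 <= 8^-j, the sum
   S of the 4^j (D j)^2 has finite integral. Where S is finite the increments are
   O(2^-j), so that (F (n j) - h)^2 <= 4^(1-j) S everywhere, and this can be
   integrated without appeal to Minkowski or Fatou. *)
Lemma square_integrable_complete (F : nat -> T -> R) :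
  (forall n, square_integrable mu (F n)) ->
  (forall e : R, 0 < e -> exists N, forall m n, (N <= m)%N -> (N <= n)%N ->
     (sqint mu (fun x => F m x - F n x)%R <= e%:E)%E) ->
  exists2 h, square_integrable mu h /\ (forall x, (forall n, F n x = 0) -> h x = 0) &
    forall e : R, 0 < e -> exists N, forall n, (N <= n)%N ->
      (sqint mu (fun x => F n x - h x)%R <= e%:E)%E.
Proof.
move=> F2 cF; have mF n : measurable_fun setT (F n) by have [] := F2 n.
have e4 : 2 ^+ 2 = 4 :> R by rewrite -natrX.
have e0 (j : nat) : 0 < (8 ^+ j)^-1 :> R by rewrite invr_gt0 exprn_gt0.
have [N HN] := choice (fun j => cF _ (e0 j)).
(* Summing the ranks makes both n j and n (j + 1) at least N j. *)
pose n j := (\sum_(0 <= i < j.+1) N i)%N.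
have Nn j : (N j <= n j)%N by rewrite /n big_nat_recr//= leq_addl.
have NnS j : (N j <= n j.+1)%N.
  by rewrite /n big_nat_recr//=; apply: leq_trans (Nn j) (leq_addr _ _).
pose D j x := F (n j.+1) x - F (n j) x.
have mD j : measurable_fun setT (D j) by exact: measurable_funB.
have sD j : (sqint mu (D j) <= (8 ^+ j)^-1%:E)%E by exact: HN.
pose Tj j x : \bar R := (4 ^+ j * (D j x) ^+ 2)%:E.
have Tj0 j x : (0 <= Tj j x)%E by rewrite lee_fin mulr_ge0 ?sqr_ge0 ?exprn_ge0.
have mTj j : measurable_fun setT (Tj j).
  apply/measurable_EFinP; apply: measurable_funM; first exact: measurable_cst.
  exact: measurable_funX.
pose S x : \bar R := (\sum_(0 <= j <oo) Tj j x)%E.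
have S0 x : (0 <= S x)%E by exact: nneseries_ge0.
have mS : measurable_fun setT S by exact: ge0_emeasurable_sum.
have IS : (\int[mu]_x S x <= 2%:E)%E.
  rewrite /S integral_nneseries//.
  apply: lime_le; first by apply: is_cvg_nneseries => j _ _; exact: integral_ge0.
  apply: nearW => k.
  apply: (@le_trans _ _ (\sum_(0 <= j < k) ((2 ^+ j)^-1)%:E)%E).
    apply: lee_sum => j _; rewrite /Tj.
    under eq_integral do rewrite EFinM.
    rewrite (ge0_integralZl mu measurableT); last 3 first.
    - exact: (measurable_sqr (mD j)).
    - by move=> x _; rewrite lee_fin sqr_ge0.
    - by rewrite lee_fin exprn_ge0.
    apply: le_trans (lee_wpmul2l _ (sD j)) _; first by rewrite lee_fin exprn_ge0.
    rewrite -EFinM lee_fin (_ : 8 = 4 * 2 :> R); last by lra.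
    by rewrite exprMn invfM mulrA divff ?mul1r// expf_neq0.
  rewrite sumEFin lee_fin.
  have -> : \sum_(0 <= j < k) (2 ^+ j)^-1 = 2 - 2 / 2 ^+ k :> R.
    elim: k => [|k ih]; first by rewrite big_nil expr0 divr1 subrr.
    rewrite big_nat_recr//= ih exprS invfM; move: (2 ^+ k)^-1 => w; lra.
  by rewrite gerBl divr_ge0// exprn_ge0.
have fS x : 0 <= fine (S x) by exact: fine_ge0.
have SE x : (S x < +oo)%E -> S x = (fine (S x))%:E.
  by move=> Sx; rewrite fineK// ge0_fin_numE.
have incr x : (S x < +oo)%E ->
    forall i, `|F (n i.+1) x - F (n i) x| <= Num.sqrt (fine (S x)) / 2 ^+ i.
  move=> Sx i.
  have : (Tj i x <= S x)%E.
    apply: le_trans (@nneseries_lim_ge R (Tj ^~ x) xpredT 0%N i.+1 _) => //.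
    by rewrite big_nat_recr//= leeDr// sume_ge0.
  rewrite (SE x Sx) lee_fin => h.
  have nn : 0 <= Num.sqrt (fine (S x)) / 2 ^+ i by rewrite divr_ge0 ?sqrtr_ge0 ?exprn_ge0.
  rewrite -ler_sqr ?nnegrE//.
  rewrite real_normK ?num_real// expr_div_n sqr_sqrtr ?fS//.
  rewrite ler_pdivlMr ?exprn_gt0// mulrC exprAC.
  by rewrite e4.
pose A := [set x | (S x < +oo)%E].
have mA : measurable A.
  by rewrite -[A]setTI; exact: emeasurable_fun_infty_o.
(* The indicator forces convergence at every point, so the limit is measurable; off [A] it is 0,
   where the bound by S = +oo is trivial. *)
pose u j x : R := F (n j) x * \1_A x.
pose h x : R := limn (u ^~ x).
have uA x : A x -> u ^~ x = (fun j => F (n j) x).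
  by move=> Ax; apply/funext => j; rewrite /u indicE mem_set// mulr1.
have ucvg x : u ^~ x @ \oo --> h x.
  have [Ax|Ax] := pselect (A x).
    by rewrite /h uA//; have [] := geometric_increments_cvg (incr x Ax).
  rewrite /h (_ : u ^~ x = cst 0); first by apply: is_cvg_cst.
  by apply/funext => j; rewrite /u indicE memNset// mulr0.
have mh : measurable_fun setT h.
  apply: (measurable_fun_cvg (h := u)) => [j|x _]; last exact: ucvg.
  by apply: measurable_funM => //; exact: measurable_indic.
have hD j x : (((F (n j) x - h x) ^+ 2)%:E <= (4 / 4 ^+ j)%:E * S x)%E.
  have p0 : 0 < 4 / 4 ^+ j :> R by rewrite divr_gt0// exprn_gt0.
  have [Ax|Ax] := pselect (A x); last first.
    have -> : S x = +oo%E.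
      by apply/eqP; rewrite eq_le leey/= leNgt; apply/negP.
    by rewrite gt0_muley ?leey// lte_fin.
  have [_ /(_ j)] := geometric_increments_cvg (incr x Ax).
  rewrite -(uA x Ax) -/(h x) (SE x Ax) -EFinM lee_fin => hj.
  have nn : 0 <= 2 * Num.sqrt (fine (S x)) / 2 ^+ j.
    by rewrite divr_ge0 ?exprn_ge0// mulr_ge0// sqrtr_ge0.
  rewrite -ler_sqr ?nnegrE// distrC real_normK ?num_real// in hj.
  have h2 : (F (n j) x - h x) ^+ 2 <= (2 * Num.sqrt (fine (S x)) / 2 ^+ j) ^+ 2.
    exact: hj.
  apply: le_trans h2 _.
  rewrite expr_div_n exprMn sqr_sqrtr ?fS// exprAC.
  by rewrite e4 [leLHS]mulrAC lexx.
have sh j : (sqint mu (fun x => F (n j) x - h x)%R <= (4 / 4 ^+ j * 2)%:E)%E.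
  have p0 : 0 <= 4 / 4 ^+ j :> R by rewrite divr_ge0// exprn_ge0.
  apply: (@le_trans _ _ (\int[mu]_x ((4 / 4 ^+ j)%:E * S x))%E).
    apply: ge0_le_integral => //.
    - by move=> x _; rewrite lee_fin sqr_ge0.
    - by apply: measurable_sqr; exact: measurable_funB.
    - exact: measurable_funeM.
  rewrite (ge0_integralZl mu measurableT) ?lee_fin// [leRHS]EFinM.
  by apply: lee_wpmul2l => //; rewrite lee_fin.
have h2 : square_integrable mu h.
  split=> //.
  have := sqint_lin_le mu 1 (-1) (mF (n 0%N)) (measurable_funB (mF (n 0%N)) mh).
  rewrite (_ : (fun x => _) = h); last by apply/funext => x; rewrite /=; ring.
  move=> le1; apply: le_lt_trans le1 _.
  have [_ s1] := F2 (n 0%N); have s2 := le_lt_trans (sh 0%N) (ltry _).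
  by apply: lte_add_pinfty; apply: lte_mul_pinfty => //; rewrite lee_fin mulr_ge0// sqr_ge0.
exists h.
  split=> // x Fx0; rewrite /h (_ : u ^~ x = cst 0) ?lim_cst//.
  by apply/funext => j; rewrite /u Fx0 mul0r.
move=> e ep.
(* Passing through F (n k), the squared distance to h is at most 2 / 8^k + 16 / 4^k, hence at most
   20 / 2^k. *)
have : (20 : R) * (2^-1) ^+ k @[k --> \oo] --> (0 : R).
  rewrite -[X in _ --> X](mulr0 (20 : R)); apply: cvgMr; apply: cvg_expr.
  by rewrite gtr0_norm// invf_lt1// ltr1n.
move=> /cvgrPdist_lt/(_ _ ep) [k _ /(_ k (leqnn k))].
rewrite sub0r normrN ger0_norm; last by rewrite mulr_ge0// exprn_ge0.
move=> ke; exists (N k) => m Nm.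
have := sqint_lin_le mu 1 1 (measurable_funB (mF m) (mF (n k))) (measurable_funB (mF (n k)) mh).
rewrite (_ : (fun x => _) = (fun x => F m x - h x)); last by apply/funext => x; rewrite /=; ring.
move=> le1; apply: le_trans le1 _.
have t0 : (0 <= (2 * 1 ^+ 2)%:E :> \bar R)%E by rewrite lee_fin.
apply: le_trans (leeD (lee_wpmul2l t0 (HN k m (n k) Nm (Nn k))) (lee_wpmul2l t0 (sh k))) _.
rewrite -!EFinM -EFinD lee_fin; apply: le_trans (ltW ke).
rewrite exprVn expr1n mulr1.
have l1 : (8 ^+ k)^-1 <= (2 ^+ k)^-1 :> R.
  by rewrite lef_pV2 ?posrE ?exprn_gt0// lerXn2r ?nnegrE// ler_nat.
have l2 : (4 ^+ k)^-1 <= (2 ^+ k)^-1 :> R.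
  by rewrite lef_pV2 ?posrE ?exprn_gt0// lerXn2r ?nnegrE// ler_nat.
have l3 : 0 <= (2 ^+ k)^-1 :> R by rewrite invr_ge0 exprn_ge0.
rewrite ?mulr1; move: l1 l2 l3; move: (8 ^+ k)^-1 (4 ^+ k)^-1 (2 ^+ k)^-1 => a b c; lra.
Qed.

End completeness.

(** * Inner product and orthonormal series in L^2(Omega) *)

Section hilbert.
Context (R : realType) (N : nat) (Omega : set 'rV[R]_N).
Local Notation E := 'rV[R]_N.
Local Notation mu := (lebesgue_rV R N).
Local Notation L2 := (L2 Omega).
Local Notation dot := (L2dot Omega).
Local Notation L2norm := (L2norm Omega).
Implicit Types (f g h : E -> R) (e : nat -> E -> R) (c : nat -> R) (a b : R).

Lemma patch_lin a b f g : (fun y => a * f y + b * g y) \_ Omega =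
  (fun y => a * (f \_ Omega) y + b * (g \_ Omega) y).
Proof.
by apply/funext => y; rewrite !patchE; case: ifP => // _; rewrite !mulr0 addr0.
Qed.

Lemma L2P f : L2 f <-> square_integrable mu (f \_ Omega).
Proof. exact: Lfun2P. Qed.

Lemma L2_lin a b f g : L2 f -> L2 g -> L2 (fun y => a * f y + b * g y).
Proof.
by move=> /L2P f2 /L2P g2; apply/L2P; rewrite patch_lin; exact: square_integrable_lin.
Qed.

Lemma L2dotE f g : dot f g = \int[mu]_y ((f \_ Omega) y * (g \_ Omega) y).
Proof.
rewrite /L2dot Rintegral_mkcond; congr Rintegral; apply/funext => y.
by rewrite !patchE; case: ifP => // _; rewrite mulr0.
Qed.

Lemma L2dot_integrable f g : L2 f -> L2 g ->
  mu.-integrable setT (EFin \o (fun y => (f \_ Omega) y * (g \_ Omega) y)).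
Proof. by move=> f2 g2; apply/Lfun1_integrable; exact: Lfun2_mul_Lfun1. Qed.

Lemma L2dotC f g : dot f g = dot g f.
Proof. by rewrite !L2dotE; apply: eq_Rintegral => y _; rewrite mulrC. Qed.

Lemma L2dot_linl a b f g h : L2 f -> L2 g -> L2 h ->
  dot (fun y => a * f y + b * g y) h = a * dot f h + b * dot g h.
Proof.
move=> f2 g2 h2; rewrite !L2dotE patch_lin.
have ifh := L2dot_integrable f2 h2; have igh := L2dot_integrable g2 h2.
rewrite -(RintegralZl a measurableT ifh) -(RintegralZl b measurableT igh).
rewrite -(RintegralD measurableT).
- by apply: eq_Rintegral => y _; ring.
- exact: (integrableZl measurableT a ifh).
- exact: (integrableZl measurableT b igh).
Qed.

Lemma L2dot_linr a b f g h : L2 f -> L2 g -> L2 h ->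
  dot h (fun y => a * f y + b * g y) = a * dot h f + b * dot h g.
Proof. by move=> f2 g2 h2; rewrite L2dotC L2dot_linl// ![dot h _]L2dotC. Qed.

Lemma L2dot_sq_lin a b f g : L2 f -> L2 g ->
  dot (fun y => a * f y + b * g y) (fun y => a * f y + b * g y) =
  a ^+ 2 * dot f f + 2 * a * b * dot f g + b ^+ 2 * dot g g.
Proof.
move=> f2 g2; rewrite L2dot_linl ?L2dot_linr//; last exact: L2_lin.
by rewrite [dot g f]L2dotC; ring.
Qed.

Lemma L2dot_ge0 f : 0 <= dot f f.
Proof. by rewrite L2dotE; apply: Rintegral_ge0 => y _; rewrite -expr2 sqr_ge0. Qed.

Lemma L2dot_sqint f : dot f f = fine (sqint mu (f \_ Omega)).
Proof. by rewrite L2dotE. Qed.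

Lemma L2norm_sqrt f : L2 f -> L2norm f = (Num.sqrt (dot f f))%:E.
Proof. by move=> /L2P f2; rewrite L2dot_sqint -Lnorm2_sqrt. Qed.

Lemma L2dot_eq0 f : L2 f -> dot f f = 0 -> {ae mu, forall y, Omega y -> f y = 0}.
Proof.
move=> f2 ff; have := L2norm_sqrt f2; rewrite ff sqrtr0 => /Lnorm_eq0_eq0.
have /L2P[mf _] := f2.
have mEf : measurable_fun setT (EFin \o (f \_ Omega)) by apply/measurable_EFinP.
have p0 : (0 < (2%:E : \bar R))%E by rewrite lte_fin.
move=> /(_ mEf p0); apply: filterS => y /= /(_ Logic.I) fy Oy.
by move: fy; rewrite patchE mem_set// => -[].
Qed.

Definition nrm f := Num.sqrt (dot f f).

Lemma nrm_ge0 f : 0 <= nrm f. Proof. exact: sqrtr_ge0. Qed.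

Lemma sqr_nrm f : nrm f ^+ 2 = dot f f.
Proof. by rewrite sqr_sqrtr ?L2dot_ge0. Qed.

Lemma L2_cauchy_schwarz f g : L2 f -> L2 g -> `|dot f g| <= nrm f * nrm g.
Proof.
move=> f2 g2; rewrite -ler_sqr ?nnegrE ?mulr_ge0 ?nrm_ge0// real_normK ?num_real//.
rewrite exprMn !sqr_nrm.
have [gg|gg] := eqVneq (dot g g) 0.
  have [->|fg] := eqVneq (dot f g) 0; first by rewrite expr0n mulr_ge0 ?L2dot_ge0.
  (* If g has zero norm but is not orthogonal to f, this multiple of g is chosen to give the
     quadratic form the value -1. *)
  have := L2dot_ge0 (fun y => 1 * f y + (- (dot f f + 1) / (2 * dot f g)) * g y).
  rewrite L2dot_sq_lin// gg mulr0 addr0 expr1n mul1r.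
  rewrite (_ : 2 * 1 * _ * _ = - (dot f f + 1)); last by field.
  by rewrite opprD addrA subrr sub0r ler0N1.
have {}gg : 0 < dot g g by rewrite lt_neqAle eq_sym gg L2dot_ge0.
(* The component of f orthogonal to g, scaled by (g, g) to avoid a division. *)
have := L2dot_ge0 (fun y => dot g g * f y + (- dot f g) * g y).
rewrite L2dot_sq_lin//.
rewrite (_ : _ + _ = dot g g * (dot f f * dot g g - dot f g ^+ 2)); last by ring.
by rewrite pmulr_rge0// subr_ge0.
Qed.

Lemma nrm_lin a b f g : L2 f -> L2 g ->
  nrm (fun y => a * f y + b * g y) <= `|a| * nrm f + `|b| * nrm g.
Proof.
move=> f2 g2; rewrite -ler_sqr ?nnegrE ?nrm_ge0 ?addr_ge0 ?mulr_ge0 ?nrm_ge0//.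
rewrite sqr_nrm L2dot_sq_lin// sqrrD !exprMn !sqr_nrm !real_normK ?num_real//.
have h : a * b * dot f g <= (`|a| * nrm f) * (`|b| * nrm g).
  apply: le_trans (ler_norm _) _; rewrite !normrM [leRHS]mulrACA.
  by rewrite ler_wpM2l ?mulr_ge0// L2_cauchy_schwarz.
by rewrite lerD2r lerD2l -[leRHS]mulr_natl -2!mulrA ler_wpM2l// mulrA.
Qed.

Lemma nrmB_le f g : L2 f -> L2 g -> `|nrm f - nrm g| <= nrm (fun y => f y - g y).
Proof.
move=> f2 g2.
have subE h k : (fun y => h y - k y) = (fun y => 1 * h y + (-1) * k y) :> (E -> R).
  by apply/funext => y; rewrite mul1r mulN1r.
have fg2 : L2 (fun y => f y - g y) by rewrite subE; exact: L2_lin.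
rewrite ler_distl; apply/andP; split.
  have := nrm_lin 1 (-1) f2 fg2.
  rewrite (_ : (fun y => _) = g); last by apply/funext => y /=; ring.
  by rewrite normrN normr1 !mul1r lerBlDr.
have := nrm_lin 1 1 fg2 g2.
rewrite (_ : (fun y => _) = f); last by apply/funext => y /=; ring.
by rewrite normr1 !mul1r addrC.
Qed.

Lemma L2seriesP e c h : (forall n, L2 (fun y => \sum_(0 <= k < n) c k * e k y)) ->
  L2series Omega e c h <->
  L2 h /\ (fun n => nrm (fun y => \sum_(0 <= k < n) c k * e k y - h y)) @ \oo --> (0 : R).
Proof.
move=> S2.
have nE (h2 : L2 h) n : L2norm (fun y => \sum_(0 <= k < n) c k * e k y - h y) =
    (nrm (fun y => \sum_(0 <= k < n) c k * e k y - h y))%:E.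
  rewrite L2norm_sqrt//.
  rewrite (_ : (fun y => _) = (fun y => 1 * (\sum_(0 <= k < n) c k * e k y) + (-1) * h y)).
    exact: L2_lin.
  by apply/funext => y; rewrite mul1r mulN1r.
split=> -[h2 hh]; split => //.
  have /fine_cvgP[_] := hh; apply: cvg_trans; apply: near_eq_cvg; apply: nearW => n /=.
  by rewrite nE.
rewrite /L2cvg; under eq_fun do rewrite (nE h2).
by apply: cvg_EFin hh; exact: nearW.
Qed.

Variable e : nat -> E -> R.
Hypotheses (e2 : forall k, L2 (e k))
  (eON : forall j k, dot (e j) (e k) = (j == k)%:R).

Definition psum c n : E -> R := fun y => \sum_(0 <= k < n) c k * e k y.

Lemma psum0 c : psum c 0 = fun=> 0.
Proof. by apply/funext => y; rewrite /psum big_nil. Qed.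

Lemma psumS c n : psum c n.+1 = fun y => 1 * psum c n y + c n * e n y.
Proof. by apply/funext => y; rewrite /psum big_nat_recr//= mul1r. Qed.

Lemma L2_0 : L2 (fun=> 0).
Proof.
have := L2_lin 0 0 (e2 0) (e2 0).
by rewrite (_ : (fun y => _) = (fun=> 0)); last by apply/funext => y; rewrite !mul0r addr0.
Qed.

Lemma L2dot0l h : dot (fun=> 0) h = 0.
Proof.
rewrite L2dotE (_ : (fun y => _) = cst 0) ?Rintegral_cst ?mul0r//.
by apply/funext => y; rewrite patchE; case: ifP => _; rewrite mul0r.
Qed.

Lemma L2_psum c n : L2 (psum c n).
Proof.
elim: n => [|n ih]; first by rewrite psum0; exact: L2_0.
by rewrite psumS; exact: L2_lin.
Qed.

Lemma dot_psum_e c n k : dot (psum c n) (e k) = if (k < n)%N then c k else 0.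
Proof.
elim: n => [|n ih]; first by rewrite psum0 L2dot0l ltn0.
rewrite psumS L2dot_linl//; last exact: L2_psum.
rewrite ih eON mul1r; have [nk|nk|->] := ltngtP n k.
- by rewrite ltnS leqNgt nk/= mulr0 addr0.
- by rewrite ltnS (ltnW nk) mulr0 addr0.
- by rewrite ltnSn add0r mulr1.
Qed.

(** Covers both the squares (m = n) and the cross terms that occur in distances between partial
    sums. *)
Lemma dot_psum c m n : (m <= n)%N ->
  dot (psum c n) (psum c m) = series (fun k => c k ^+ 2) m.
Proof.
elim: m => [|m ih] mn; first by rewrite psum0 L2dotC L2dot0l /series/= big_nil.
rewrite psumS L2dot_linr//; [|exact: L2_psum..].
rewrite ih ?(ltnW mn)// dot_psum_e mn mul1r /series/= [RHS]big_nat_recr//=.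
Qed.

Lemma L2_sub f g : L2 f -> L2 g -> L2 (fun y => f y - g y).
Proof.
move=> f2 g2; rewrite (_ : (fun y => _) = (fun y => 1 * f y + (-1) * g y)); first exact: L2_lin.
by apply/funext => y; rewrite mul1r mulN1r.
Qed.

Lemma L2dot_sub_sq f g : L2 f -> L2 g ->
  dot (fun y => f y - g y) (fun y => f y - g y) = dot f f - 2 * dot f g + dot g g.
Proof.
move=> f2 g2; have := L2dot_sq_lin 1 (-1) f2 g2.
rewrite (_ : (fun y => _) = (fun y => f y - g y)); last by apply/funext => y; rewrite mul1r mulN1r.
by move=> ->; ring.
Qed.

Lemma L2series_cvgP c h : L2series Omega e c h <->
  L2 h /\ (fun n => nrm (fun y => psum c n y - h y)) @ \oo --> (0 : R).
Proof. by apply: L2seriesP => n; exact: L2_psum. Qed.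

(** Squared distances between partial sums are differences of partial sums of the series of c_k^2,
    so they form a Cauchy sequence in L^2. *)
Lemma riesz_fischer c : cvgn (series (fun k => c k ^+ 2)) ->
  exists h, L2series Omega e c h.
Proof.
move=> cc; pose F n := psum c n \_ Omega.
have F2 n : square_integrable mu (F n) by apply/L2P; exact: L2_psum.
have FE m n : (fun x => F m x - F n x) = (fun y => psum c m y - psum c n y) \_ Omega.
  by apply/funext => y; rewrite /F !patchE; case: ifP => // _; rewrite subrr.
have sqE f : L2 f -> sqint mu (f \_ Omega) = (dot f f)%:E.
  by move=> /L2P f2; rewrite L2dot_sqint -sqint_fin.
have dE m n : (n <= m)%N -> sqint mu (fun x => F m x - F n x) =
    (series (fun k => c k ^+ 2) m - series (fun k => c k ^+ 2) n)%:E.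
  move=> nm; rewrite FE sqE; last by apply: L2_sub; exact: L2_psum.
  rewrite L2dot_sub_sq ?dot_psum//; [|exact: L2_psum..].
  by congr EFin; ring.
have symE m n : sqint mu (fun x => F m x - F n x) = sqint mu (fun x => F n x - F m x).
  by apply: eq_integral => x _; rewrite -sqrrN opprB.
have [h [h2 h0] hF] : exists2 h, square_integrable mu h /\
    (forall x, (forall n, F n x = 0) -> h x = 0) &
    forall e : R, 0 < e -> exists N, forall n, (N <= n)%N ->
      (sqint mu (fun x => F n x - h x)%R <= e%:E)%E.
  apply: square_integrable_complete => // eps eps0.
  have /cvg_cauchy/cauchy_ballP/(_ _ eps0) := cc; rewrite near_simpl.
  move=> [[A B] [[a _ Aa] [b _ Bb]] AB].
  exists (maxn a b) => m n; rewrite !geq_max => /andP[am bm] /andP[an bn].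
  wlog nm : m n am bm an bn / (n <= m)%N.
    move=> wl; have [nm|mn] := leqP n m; first exact: wl.
    by rewrite symE; apply: wl => //; exact: ltnW.
  rewrite dE// lee_fin; have /= := AB (m, n) (conj (Aa m am) (Bb n bn)).
  by rewrite /ball/= => /ltW; apply: le_trans; exact: ler_norm.
(* Completeness also preserves common zeros, so the limit vanishes outside Omega and is its own
   extension by zero. *)
have hO : h \_ Omega = h.
  apply/funext => y; rewrite patchE; case: ifPn => // yO; rewrite h0// => n.
  by rewrite /F patchE (negbTE yO).
have hL2 : L2 h by apply/L2P; rewrite hO.
exists h; apply/L2series_cvgP; split => //.
apply/cvgrPdist_le => eps eps0.
have eps20 : 0 < eps ^+ 2 by rewrite exprn_gt0.
have [n0 Hn0] := hF _ eps20; exists n0 => // n /= /Hn0.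
rewrite (_ : (fun x => F n x - h x) = (fun y => psum c n y - h y) \_ Omega); last first.
  apply/funext => y; rewrite [RHS]patchE /F patchE; case: ifPn => // yO.
  by rewrite h0 ?subrr// => i; rewrite /F patchE (negbTE yO).
rewrite sqE; last by apply: L2_sub => //; exact: L2_psum.
rewrite lee_fin -sqr_nrm sub0r normrN ger0_norm ?nrm_ge0//.
by rewrite ler_sqr ?nnegrE ?nrm_ge0// ltW.
Qed.

(** Taking the k-th coefficient is continuous by Cauchy-Schwarz and constant along the partial sums
    beyond k. *)
Lemma L2series_coef c h k : L2series Omega e c h -> dot h (e k) = c k.
Proof.
move=> /L2series_cvgP[h2 hc].
have he : nrm (e k) = 1 by rewrite /nrm eON eqxx sqrtr1.
suff : (fun n => dot (psum c n) (e k)) @ \oo --> dot h (e k).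
  have : (fun n => dot (psum c n) (e k)) @ \oo --> c k.
    apply: cvg_near_cst; exists k.+1 => // n /= kn.
    by rewrite dot_psum_e kn.
  by move=> /cvg_lim <- // /cvg_lim <-.
apply/cvgrPdist_le => eps eps0; have /cvgrPdist_le/(_ _ eps0) := hc.
apply: filterS => n; rewrite sub0r normrN ger0_norm ?nrm_ge0//; apply: le_trans.
have := L2_cauchy_schwarz (L2_sub (L2_psum c n) h2) (e2 k).
rewrite he mulr1; apply: le_trans.
rewrite (_ : (fun y => _) = (fun y => 1 * psum c n y + (-1) * h y)).
  by rewrite L2dot_linl ?mul1r ?mulN1r 1?distrC//; exact: L2_psum.
by apply/funext => y; rewrite mul1r mulN1r.
Qed.

Lemma L2series_parseval c h : L2series Omega e c h ->
  series (fun k => c k ^+ 2) @ \oo --> dot h h.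
Proof.
move=> /L2series_cvgP[h2 hc].
have nc : (fun n => nrm (psum c n)) @ \oo --> nrm h.
  apply/cvgrPdist_le => eps eps0; have /cvgrPdist_le/(_ _ eps0) := hc.
  apply: filterS => n; rewrite sub0r normrN ger0_norm ?nrm_ge0//; apply: le_trans.
  by rewrite distrC; apply: nrmB_le => //; exact: L2_psum.
rewrite -sqr_nrm expr2; apply: cvg_trans (cvgM nc nc); apply: near_eq_cvg.
by apply: nearW => n; rewrite /= -expr2 sqr_nrm dot_psum.
Qed.

Lemma L2series_lin a b c c' h k :
  L2series Omega e c h -> L2series Omega e c' k ->
  L2series Omega e (fun i => a * c i + b * c' i) (fun y => a * h y + b * k y).
Proof.
move=> /L2series_cvgP[h2 hc] /L2series_cvgP[k2 kc]; apply/L2series_cvgP.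
split; first exact: L2_lin.
have bnd : (fun n => `|a| * nrm (fun y => psum c n y - h y) +
    `|b| * nrm (fun y => psum c' n y - k y)) @ \oo --> (0 : R).
  rewrite -[X in _ --> X](addr0 0) -[X in _ --> X + _](mulr0 `|a|) -[X in _ --> _ + X](mulr0 `|b|).
  by apply: cvgD; apply: cvgMr.
apply: (squeeze_cvgr _ (cvg_cst 0) bnd); apply: nearW => n; rewrite nrm_ge0/=.
apply: le_trans (nrm_lin a b (L2_sub (L2_psum c n) h2) (L2_sub (L2_psum c' n) k2)).
rewrite le_eqVlt (_ : (fun y => _) = (fun y => a * (psum c n y - h y) + b * (psum c' n y - k y))) ?eqxx//.
apply/funext => y; rewrite (_ : psum _ _ _ = a * psum c n y + b * psum c' n y); first by ring.
by rewrite /psum !mulr_sumr -big_split/=; apply: eq_bigr => i _; ring.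
Qed.

Lemma eq_L2series c c' h : c =1 c' -> L2series Omega e c h -> L2series Omega e c' h.
Proof. by move=> /funext ->. Qed.

Lemma L2series_dominated (M : R) c c' h k : 0 <= M ->
  (forall i, `|c i| <= M * `|c' i|) ->
  L2series Omega e c h -> L2series Omega e c' k -> nrm h <= M * nrm k.
Proof.
move=> M0 cc' hc kc; rewrite -ler_sqr ?nnegrE ?mulr_ge0 ?nrm_ge0// exprMn !sqr_nrm.
apply: (ler_cvg_to (L2series_parseval hc)).
  by apply: cvgMr; exact: (L2series_parseval kc).
apply: nearW => n /=; rewrite /series/= mulr_sumr; apply: ler_sum => i _.
rewrite -[c i ^+ 2]real_normK ?num_real// -[c' i ^+ 2]real_normK ?num_real// -exprMn.
by rewrite ler_sqr ?nnegrE ?mulr_ge0.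
Qed.

Lemma riesz_fischer_dominated (M : R) c c' k : 0 <= M ->
  (forall i, `|c i| <= M * `|c' i|) -> L2series Omega e c' k ->
  exists h, L2series Omega e c h.
Proof.
move=> M0 cc' kc; apply: riesz_fischer.
apply: (@series_le_cvg _ _ (fun i => M ^+ 2 * c' i ^+ 2)) => [i|i|i|].
- exact: sqr_ge0.
- by rewrite mulr_ge0 ?sqr_ge0.
- rewrite -[c i ^+ 2]real_normK ?num_real// -[c' i ^+ 2]real_normK ?num_real// -exprMn.
  by rewrite ler_sqr ?nnegrE ?mulr_ge0.
- apply: (@is_cvg_seriesZ _ _ (M ^+ 2)).
  by apply: cvgP; exact: L2series_parseval kc.
Qed.

(** The difference has zero coefficients, hence zero norm by Parseval. *)
Lemma L2series_ae_eq c h k : L2series Omega e c h -> L2series Omega e c k ->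
  {ae mu, forall y, Omega y -> h y = k y}.
Proof.
move=> hc kc.
have zc : L2series Omega e (fun=> 0) (fun y => 1 * h y + (-1) * k y).
  by apply: (eq_L2series _ (L2series_lin 1 (-1) hc kc)) => i; rewrite mul1r mulN1r subrr.
have [z2 _] := zc.
have : dot (fun y => 1 * h y + (-1) * k y) (fun y => 1 * h y + (-1) * k y) = 0.
  have /cvg_lim <- // := L2series_parseval zc.
  rewrite (_ : series _ = cst 0) ?lim_cst//.
  by apply/funext => n; rewrite /series/= big1// => i _; rewrite expr0n.
move=> /(L2dot_eq0 z2); apply: filterS => y hk /hk.
by rewrite mul1r mulN1r => /eqP; rewrite subr_eq0 => /eqP.
Qed.

End hilbert.

(** * The boundary value problem *)

Section eigenfunction_series.
Context (R : realType) (N : nat) (Omega : set 'rV[R]_N).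
Local Notation E := 'rV[R]_N.
Local Notation mu := (lebesgue_rV R N).
Local Notation dot := (L2dot Omega).
Local Notation nrm := (nrm Omega).
Variable e : nat -> E -> R.
Hypotheses (e2 : forall k, L2 Omega (e k))
  (eON : forall j k, dot (e j) (e k) = (j == k)%:R).

(** The common mechanism of all estimates: one summand of the coefficients is dominated by those of
    the datum f (or -L f), the other by those of g. Parseval handles each, the triangle inequality
    joins them, and the sum is obtained together with its bound. *)
Lemma L2series_split (M1 M2 : R) (c d1 d2 c1 c2 : R^nat) (k1 k2 : E -> R) :
  0 <= M1 -> 0 <= M2 -> (forall i, c i = d1 i + d2 i) ->
  (forall i, `|d1 i| <= M1 * `|c1 i|) -> (forall i, `|d2 i| <= M2 * `|c2 i|) ->
  L2series Omega e c1 k1 -> L2series Omega e c2 k2 ->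
  (exists h, L2series Omega e c h) /\
  forall h, L2series Omega e c h -> nrm h <= M1 * nrm k1 + M2 * nrm k2.
Proof.
move=> M10 M20 cd d1c d2c c1k c2k.
have [h1 s1] := riesz_fischer_dominated e2 eON M10 d1c c1k.
have [h2 s2] := riesz_fischer_dominated e2 eON M20 d2c c2k.
have s12 : L2series Omega e c (fun y => 1 * h1 y + 1 * h2 y).
  apply: (eq_L2series _ (L2series_lin e2 1 1 s1 s2)) => i.
  by rewrite !mul1r cd.
split; first by exists (fun y => 1 * h1 y + 1 * h2 y).
move=> h sh.
(* By Parseval the norm depends on the coefficients only, so any sum of the series may replace the
   constructed one. *)
have -> : nrm h = nrm (fun y => 1 * h1 y + 1 * h2 y).
  congr Num.sqrt; have /cvg_lim <- // := L2series_parseval e2 eON sh.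
  by have /cvg_lim <- // := L2series_parseval e2 eON s12.
have [h12 _] := s1; have [h22 _] := s2.
apply: le_trans (nrm_lin 1 1 h12 h22) _; rewrite normr1 !mul1r.
by apply: lerD; [exact: (L2series_dominated e2 eON M10 d1c s1 c1k)|
                 exact: (L2series_dominated e2 eON M20 d2c s2 c2k)].
Qed.

Variable lam : R^nat.

(** Here [h] plays the role of -L f: the norm of D(-L) is the L^2 norm of its image. *)
Lemma L2series_DLnorm (f h : E -> R) :
  L2series Omega e (fun k => lam k * dot f (e k)) h ->
  DLnorm Omega lam e f = (nrm h)%:E.
Proof.
move=> sh; rewrite /DLnorm.
have -> : (\sum_(0 <= k <oo) ((lam k) ^+ 2 * `|dot f (e k)| ^+ 2)%:E = (dot h h)%:E)%E.
  apply/cvg_lim => //; under eq_fun do rewrite sumEFin.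
  apply: cvg_EFin; first exact: nearW.
  apply: cvg_trans (L2series_parseval e2 eON sh); apply: near_eq_cvg; apply: nearW => n.
  rewrite /comp /series/=; apply: eq_bigr => k _.
  by rewrite exprMn real_normK ?num_real.
by rewrite poweR_EFin powR12_sqrt ?L2dot_ge0.
Qed.

Lemma DL_L2series (f : E -> R) : DL Omega lam e f ->
  exists h, L2series Omega e (fun k => lam k * dot f (e k)) h.
Proof.
move=> [_ fDL]; apply: (riesz_fischer e2 eON).
rewrite (_ : (fun k => _) = (fun k => (lam k) ^+ 2 * `|dot f (e k)| ^+ 2)); last first.
  by apply/funext => k; rewrite exprMn real_normK ?num_real.
apply: nnseries_is_cvg; first by move=> i; rewrite mulr_ge0 ?sqr_ge0.
apply: lty_poweRy fDL; by rewrite invr_eq0 pnatr_eq0.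
Qed.

End eigenfunction_series.

(** * Closed form of the solution coefficients and of their derivatives *)

Section solution_coefficients.
Context (R : realType) (alpha beta : R).
Hypothesis (alpha_gt0 : 0 < alpha) (alpha_le1 : alpha <= 1) (beta_ge0 : 0 <= beta).
Local Notation gam := (alpha + beta).

(** Both constants are values of Gamma p / Gamma (p + alpha), at p = 1 + beta and at the larger p =
    1 + alpha + 2 beta. *)
Lemma eta2_div_eta3_ge1 : 1 <= eta2 alpha beta / eta3 alpha beta.
Proof.
have q0 : 0 < 1 + alpha + 2 * beta by rewrite ltr_wpDr ?mulr_ge0// addr_gt0.
have e0 : 0 < eta3 alpha beta.
  rewrite /eta3 !Gamma_gammaf divr_gt0// gammaf_gt0//.
  by rewrite ltr_wpDr ?mulr_ge0// addr_gt0// mulr_gt0.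
rewrite (ler_pdivlMr _ _ e0) mul1r /eta2 /eta3 !Gamma_gammaf.
rewrite (_ : 1 + 2 * alpha + 2 * beta = 1 + alpha + 2 * beta + alpha); last by ring.
rewrite (_ : 1 + alpha + beta = 1 + beta + alpha); last by ring.
apply: le_gammaf_ratio => //; first by rewrite ltr_wpDr.
by rewrite -addrA lerD2l mulr_natl mulr2n addrA lerDr addr_ge0// ltW.
Qed.

(** The weight x^(-beta) cancels the x^beta of [caputo_ks_mode]. Affine functions of a mode, known
    for s > 0 only, are stable under [Dx], so the lemma can be iterated. *)
Lemma Dx_ks_mode (U : R -> R) (a b w x : R) : 0 < x ->
  (forall s, 0 < s -> U s = a * ks_mode alpha beta w s + b) ->
  Dx alpha beta U x = a * w * ks_mode alpha beta w x.
Proof.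
move=> x0 UE; rewrite /Dx.
have rm := ks_mode_regular alpha_gt0 alpha_le1 beta_ge0 w.
have rc := caputo_regular_cst alpha (1 : R).
have -> : caputo alpha U x = caputo alpha (fun s => a * ks_mode alpha beta w s + b * cst 1 s) x.
  by apply: eq_caputo => // s s0; rewrite UE//= mulr1.
rewrite (caputo_lin a b rm rc x0) (caputo_cst _ _ x0) mulr0 addr0.
rewrite (caputo_ks_mode alpha_gt0 alpha_le1 beta_ge0 _ x0).
have xb : x `^ beta != 0 by rewrite gt_eqF// powR_gt0.
move: (ks_mode _ _ _ _) => v; move: (x `^ beta) xb => t t0.
by field.
Qed.

Lemma D2x_ks_mode (U : R -> R) (a b w x : R) : 0 < x ->
  (forall s, 0 < s -> U s = a * ks_mode alpha beta w s + b) ->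
  D2x alpha beta U x = a * w ^+ 2 * ks_mode alpha beta w x.
Proof.
move=> x0 UE; rewrite /D2x (@Dx_ks_mode _ (a * w) 0 w)//.
  by rewrite expr2 !mulrA.
by move=> s s0; rewrite addr0 (@Dx_ks_mode _ a b w).
Qed.

Context (N : nat) (Omega : set 'rV[R]_N) (lam : R^nat) (phi : nat -> 'rV[R]_N -> R).
Local Notation dot := (L2dot Omega).
Hypothesis lam_gt0 : forall k, 0 < lam k.

Definition mode k x : R := ks_mode alpha beta (- Num.sqrt (lam k)) x.

Lemma mode_ge0 k x : 0 <= x -> 0 <= mode k x.
Proof. by apply: ks_modeN_ge0 => //; rewrite sqrtr_gt0. Qed.

Lemma mode_le1 k x : 0 <= x -> mode k x <= 1.
Proof. by apply: ks_modeN_le1 => //; rewrite sqrtr_gt0. Qed.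

Lemma solution_coefE f g k x : 
  solution_coef Omega lam phi alpha beta f g k x =
  dot f (phi k) * mode k x - dot g (phi k) / lam k * (1 - mode k x).
Proof.
rewrite /solution_coef (ksE alpha beta) -/(mode k x).
set s := Num.sqrt (lam k); set K := kilbas_saigo _ _ _ _.
have s0 : s != 0 by rewrite gt_eqF// sqrtr_gt0.
have ss : lam k = s * s by rewrite -expr2 sqr_sqrtr// ltW.
have := ks_second alpha_gt0 beta_ge0 (- s * x `^ gam); rewrite -/K.
rewrite -[ks _ _ _]/(mode k x) ss.
move: (x `^ gam) (mode k x) (eta2 _ _) => t v e h.
have -> : v = 1 + e * (- s * t) * K by rewrite h; ring.
by field.
Qed.

End solution_coefficients.

(** All modes are one decreasing function read at sqrt(lambda_k) x^gam; mode 0 has the smallest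
    argument and is the slowest to approach l. *)
Lemma mode_cvg (R : realType) (alpha beta : R) (alpha_gt0 : 0 < alpha) (alpha_le1 : alpha <= 1)
    (beta_ge0 : 0 <= beta) (lam : R^nat) (lam0 : 0 < lam 0%N) (lamS : forall k, lam 0%N <= lam k) :
  exists l : R, [/\ 0 <= l <= 1,
    (mode alpha beta lam 0 x - l) @[x --> +oo] --> (0 : R)
    & forall k x, 0 <= x -> 0 <= mode alpha beta lam k x - l <= mode alpha beta lam 0 x - l].
Proof.
have [l lcvg lle] := ksN_cvg alpha_gt0 alpha_le1 beta_ge0.
have gam0 := ks_gam_gt0 alpha_gt0 beta_ge0.
have modeE k x : mode alpha beta lam k x =
    ks alpha beta (- (Num.sqrt (lam k) * x `^ (alpha + beta))).
  by rewrite /mode ks_modeE mulNr.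
have z0 k x : 0 <= Num.sqrt (lam k) * x `^ (alpha + beta).
  by rewrite mulr_ge0 ?sqrtr_ge0 ?powR_ge0.
have s0 : 0 < Num.sqrt (lam 0%N) by rewrite sqrtr_gt0.
exists l; split.
- apply/andP; split; last first.
    by apply: le_trans (lle 0 (lexx 0)) _; rewrite ksN_le1.
  apply: (ler_cvg_to (cvg_cst (0 : R)) lcvg).
  by apply: filterS (nbhs_pinfty_ge (num_real (0 : R))) => z z1; exact: ksN_ge0.
- rewrite -(subrr l); apply: cvgB; last exact: cvg_cst.
  have zoo : Num.sqrt (lam 0%N) * x `^ (alpha + beta) @[x --> +oo] --> +oo.
    apply/cvgryPge => A; have A0 : 0 <= `|A| / Num.sqrt (lam 0%N) by rewrite divr_ge0 ?sqrtr_ge0.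
    (* The threshold solves sqrt(lambda_0) x^gam = |A| for x. *)
    apply: filterS (nbhs_pinfty_ge (num_real ((`|A| / Num.sqrt (lam 0%N)) `^ (alpha + beta)^-1))).
    move=> x Ax; apply: le_trans (ler_norm A) _; rewrite mulrC -ler_pdivrMr//.
    rewrite -[leLHS]powRr1// -(mulVf (lt0r_neq0 gam0)) powRrM.
    apply: ge0_ler_powR; rewrite ?nnegrE ?powR_ge0 ?(ltW gam0)//.
    by apply: le_trans Ax; exact: powR_ge0.
  have := cvg_comp _ _ zoo lcvg; apply: cvg_trans; apply: near_eq_cvg.
  by apply: nearW => x /=; rewrite modeE.
- move=> k x x0; rewrite subr_ge0 lerD2r modeE lle//= modeE.
  by apply: ksN_anti => //; rewrite ler_wpM2r ?powR_ge0// ler_wsqrtr.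
Qed.

Unset Implicit Arguments.

Theorem theorem2 (R : realType) (N : nat) (Omega : set 'rV[R]_N)
    (L : coefficients R N) (lam : nat -> R) (phi : nat -> 'rV[R]_N -> R)
    (alpha beta : R) (f g : 'rV[R]_N -> R)
    (hN : (1 <= N)%N)
    (hOmega : smooth_bounded_domain Omega)
    (hLell : uniformly_elliptic Omega L)
    (hLsym : symmetric_operator Omega L)
    (hphi : eigenbasis Omega L lam phi)
    (halpha : 0 < alpha <= 1)
    (hbeta : 0 <= beta)
    (hf : DL Omega lam phi f)
    (hg : L2 Omega g) :
  (exists u, generalized_solution Omega lam phi alpha beta f g u) /\
  forall u, generalized_solution Omega lam phi alpha beta f g u ->
  exists D2u Lu : R -> 'rV[R]_N -> R,
    solves_bvp Omega lam phi alpha beta f g u D2u Lu /\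
    [/\ forall x, 0 < x ->
          (L2norm Omega (u x) <=
             L2norm Omega f + (eta4 alpha beta (lam 0%N))%:E * L2norm Omega g)%E,
        (ereal_sup [set L2norm Omega (D2u x) | x in `]0%R, +oo[] <=
           DLnorm Omega lam phi f +
           (1 + eta2 alpha beta / eta3 alpha beta)%:E * L2norm Omega g)%E
      & (ereal_sup [set L2norm Omega (Lu x) | x in `]0%R, +oo[] <=
           DLnorm Omega lam phi f +
           (eta2 alpha beta / eta3 alpha beta)%:E * L2norm Omega g)%E].
Proof.
case/andP: halpha => alpha_gt0 alpha_le1.
have [[e2 eON ebasis] _ lam0 lamS _] := hphi.
have lamle k : lam 0%N <= lam k.
  by elim: k => // k ih; exact: le_trans ih (lamS k).
have lam_gt0 k : 0 < lam k by exact: lt_le_trans (lamle k).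
have [f2 _] := hf.
pose fk k := L2dot Omega f (phi k).
pose gk k := L2dot Omega g (phi k).
have sf : L2series Omega phi fk f by exact: ebasis.
have sg : L2series Omega phi gk g by exact: ebasis.
(* [F] represents -L f; its L^2 norm is the D(-L) norm of f. *)
have [F sF] := DL_L2series e2 eON hf.
have FE := L2series_DLnorm e2 eON sF.
pose r := eta2 alpha beta / eta3 alpha beta.
have r1 : 1 <= r by exact: eta2_div_eta3_ge1.
have r0 : 0 <= r by exact: le_trans r1.
have eta4E : eta4 alpha beta (lam 0%N) = r / lam 0%N.
  by rewrite /eta4 /r; set a := eta2 _ _; set b := eta3 _ _; rewrite invfM mulrA.
have eta40 : 0 <= eta4 alpha beta (lam 0%N) by rewrite eta4E divr_ge0// ltW.
pose m := mode alpha beta lam.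
have m0 k x : 0 <= x -> 0 <= m k x by exact: mode_ge0.
have m1 k x : 0 <= x -> m k x <= 1 by exact: mode_le1.
have m1' k x : 0 <= x -> `|1 - m k x| <= 1.
  by move=> x0; rewrite ger0_norm ?subr_ge0 ?m1// gerBl m0.
have mn k x : 0 <= x -> `|m k x| <= 1 by move=> x0; rewrite ger0_norm ?m0 ?m1.
pose uk k x := fk k * m k x - gk k / lam k * (1 - m k x).
have ukE k x : solution_coef Omega lam phi alpha beta f g k x = uk k x.
  exact: solution_coefE.
have le_mul (a b M : R) : `|b| <= M -> `|a * b| <= M * `|a|.
  by move=> bM; rewrite normrM mulrC ler_wpM2r.
(* 1 / lambda_k <= 1 / lambda_0 <= r / lambda_0 = eta4, the last inequality because r >= 1. *)
have lamV k (c : R) : `|c| <= 1 -> `|gk k * (1 / lam k * c)| <= eta4 alpha beta (lam 0%N) * `|gk k|.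
  move=> c1; apply: le_mul; rewrite normrM eta4E -[leRHS]mulr1.
  apply: ler_pM => //; rewrite ger0_norm ?divr_ge0 ?(ltW (lam_gt0 k))//; apply: ler_pM => //.
    by rewrite invr_ge0 ltW.
  by rewrite lef_pV2 ?posrE.
have usplit x : 0 <= x -> (exists h, L2series Omega phi (uk ^~ x) h) /\
    forall h, L2series Omega phi (uk ^~ x) h ->
      nrm Omega h <= 1 * nrm Omega f + eta4 alpha beta (lam 0%N) * nrm Omega g.
  move=> x0; apply: (L2series_split e2 eON ler01 eta40 (d1 := fun k => fk k * m k x)
    (d2 := fun k => gk k * (1 / lam k * - (1 - m k x))) _ _ _ sf sg) => k.
  - by rewrite /uk; ring.
  - by apply: le_mul; exact: mn.
  - by apply: lamV; rewrite normrN m1'.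
split.
  have : forall x, exists h, 0 <= x -> L2series Omega phi (uk ^~ x) h.
    (* For x < 0 nothing is required of the solution, and [f] is a default value. *)
    move=> x; have [x0|x0] := leP 0 x; last by exists f.
    by have [[h hx] _] := usplit x x0; exists h.
  move=> /choice[u hu]; exists u => x x0.
  by apply: (eq_L2series _ (hu x x0)) => k; rewrite ukE.
move=> u u_sol.
have su x : 0 <= x -> L2series Omega phi (uk ^~ x) (u x).
  by move=> x0; apply: (eq_L2series _ (u_sol x x0)) => k; rewrite ukE.
have u2 x : 0 <= x -> L2 Omega (u x) by move=> /su[].
have uE x k : 0 <= x -> L2dot Omega (u x) (phi k) = uk k x.
  by move=> x0; exact: (L2series_coef e2 eON k (su x x0)).
have D2uE x k : 0 < x -> D2x alpha beta (fun s => L2dot Omega (u s) (phi k)) x =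
    lam k * fk k * m k x + gk k * m k x.
  (* Written as an affine function of its mode, u_k = (f_k + g_k / lambda_k) v_k - g_k /
     lambda_k. *)
  move=> x0; rewrite (D2x_ks_mode alpha_gt0 alpha_le1 hbeta
    (a := fk k + gk k / lam k) (b := - (gk k / lam k)) (w := - Num.sqrt (lam k)) x0).
    rewrite sqrrN sqr_sqrtr ?(ltW (lam_gt0 k))// -/(mode alpha beta lam k x) -/(m k x).
    by field; exact: lt0r_neq0.
  move=> s s0; rewrite (uE _ _ (ltW s0)) /uk -/(mode alpha beta lam k s) -/(m k s).
  by ring.
have LuE x k : 0 < x -> - (lam k * L2dot Omega (u x) (phi k)) =
    - (lam k * fk k * m k x) + gk k * (1 - m k x).
  move=> x0; rewrite (uE _ _ (ltW x0)) /uk; field; exact: lt0r_neq0.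
have r10 : 0 <= 1 + r by rewrite addr_ge0.
have D2split x : 0 < x -> (exists h, L2series Omega phi
      (fun k => D2x alpha beta (fun s => L2dot Omega (u s) (phi k)) x) h) /\
    forall h, L2series Omega phi
      (fun k => D2x alpha beta (fun s => L2dot Omega (u s) (phi k)) x) h ->
      nrm Omega h <= 1 * nrm Omega F + (1 + r) * nrm Omega g.
  move=> x0; apply: (L2series_split e2 eON ler01 r10 (d1 := fun k => lam k * fk k * m k x)
    (d2 := fun k => gk k * m k x) _ _ _ sF sg) => k.
  - exact: D2uE.
  - by apply: le_mul; apply: mn; exact: ltW.
  - by apply: le_mul; apply: (le_trans (mn k x (ltW x0))); rewrite lerDl.
have Lsplit x : 0 < x -> (exists h, L2series Omega phi
      (fun k => - (lam k * L2dot Omega (u x) (phi k))) h) /\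
    forall h, L2series Omega phi (fun k => - (lam k * L2dot Omega (u x) (phi k))) h ->
      nrm Omega h <= 1 * nrm Omega F + r * nrm Omega g.
  move=> x0; apply: (L2series_split e2 eON ler01 r0 (d1 := fun k => - (lam k * fk k * m k x))
    (d2 := fun k => gk k * (1 - m k x)) _ _ _ sF sg) => k.
  - exact: LuE.
  - by rewrite normrN; apply: le_mul; apply: mn; exact: ltW.
  - by apply: le_mul; apply: (le_trans (m1' k x (ltW x0))).
have [D2u sD2u] : exists D2u, applies_D2x Omega phi alpha beta u D2u.
  suff /choice[w hw] : forall x, exists h, 0 < x -> L2series Omega phi
    (fun k => D2x alpha beta (fun s => L2dot Omega (u s) (phi k)) x) h by exists w.
  move=> x; have [x0|x0] := ltP 0 x; last by exists f.
  by have [[h hx] _] := D2split x x0; exists h.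
have [Lu sLu] : exists Lu, applies_L Omega lam phi u Lu.
  suff /choice[w hw] : forall x, exists h, 0 < x -> L2series Omega phi
    (fun k => - (lam k * L2dot Omega (u x) (phi k))) h by exists w.
  move=> x; have [x0|x0] := ltP 0 x; last by exists f.
  by have [[h hx] _] := Lsplit x x0; exists h.
exists D2u, Lu; split; last first.
  have gN := L2norm_sqrt hg.
  split.
  - move=> x x0; rewrite (L2norm_sqrt (u2 x (ltW x0))) (L2norm_sqrt f2) gN.
    rewrite -EFinM -EFinD lee_fin -/(nrm Omega _) -[X in _ <= X + _]mul1r.
    by have [_] := usplit x (ltW x0); apply; exact: su (ltW x0).
  - apply: ge_ereal_sup => y [x /=]; rewrite in_itv/= andbT => x0 <-.
    have [D2 _] := sD2u x x0; rewrite (L2norm_sqrt D2) FE gN.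
    rewrite -EFinM -EFinD lee_fin -/(nrm Omega _) -[X in _ <= X + _]mul1r.
    by have [_] := D2split x x0; apply; exact: sD2u.
  - apply: ge_ereal_sup => y [x /=]; rewrite in_itv/= andbT => x0 <-.
    have [D2 _] := sLu x x0; rewrite (L2norm_sqrt D2) FE gN.
    rewrite -EFinM -EFinD lee_fin -/(nrm Omega _) -[X in _ <= X + _]mul1r.
    by have [_] := Lsplit x x0; apply; exact: sLu.
split.
- by split.
(* The k-th coefficients of D2u and Lu add up to g_k, so the equation holds almost everywhere. *)
- move=> x x0; have := L2series_lin e2 1 1 (sD2u x x0) (sLu x x0) => h.
  have {}h : L2series Omega phi gk (fun y => 1 * D2u x y + 1 * Lu x y).
    by apply: (eq_L2series _ h) => k; rewrite (D2uE _ _ x0) (LuE _ _ x0); ring.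
  by apply: filterS (L2series_ae_eq e2 eON h sg) => y hy Oy; rewrite -hy// !mul1r.
- move=> x x0; split; first exact: (u2 x (ltW x0)).
  (* -Lu is an L^2 sum of lambda_k u_k, which makes the D(-L) norm of u finite; the zero multiple
     only fits the two-term linearity lemma. *)
  have sN : L2series Omega phi (fun k => lam k * L2dot Omega (u x) (phi k))
      (fun y => (-1) * Lu x y + 0 * Lu x y).
    by apply: (eq_L2series _ (L2series_lin e2 (-1) 0 (sLu x x0) (sLu x x0))) => k; ring.
  by rewrite (L2series_DLnorm e2 eON sN) ltry.
- have h : L2series Omega phi fk (u 0).
    apply: (eq_L2series _ (su 0 (lexx 0))) => k; rewrite /uk /m /mode ks_mode0//.
    by rewrite subrr mulr1 mulr0 subr0.
  exact: (L2series_ae_eq e2 eON h sf).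
have [l [/andP[l0 l1] lcvg lm]] := mode_cvg alpha_gt0 alpha_le1 hbeta lam0 lamle.
(* The limit profile replaces every mode by l; since 0 <= l <= 1, it is summable by the same split
   as u. *)
pose ul k := fk k * l - gk k / lam k * (1 - l).
have [[v sv] _] : (exists h, L2series Omega phi ul h) /\
    forall h, L2series Omega phi ul h ->
      nrm Omega h <= 1 * nrm Omega f + eta4 alpha beta (lam 0%N) * nrm Omega g.
  apply: (L2series_split e2 eON ler01 eta40 (d1 := fun k => fk k * l)
    (d2 := fun k => gk k * (1 / lam k * - (1 - l))) _ _ _ sf sg) => k.
  - by rewrite /ul; ring.
  - by apply: le_mul; rewrite ger0_norm.
  - by apply: lamV; rewrite normrN ger0_norm ?subr_ge0// gerBl.
have [v2 _] := sv.
pose K := nrm Omega f + eta4 alpha beta (lam 0%N) * nrm Omega g.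
(* The coefficients of u x - v are (m_k - l) (f_k + g_k / lambda_k) with 0 <= m_k - l <= m_0 - l;
   this uniformity in k turns convergence of each mode into convergence of the norm. *)
have udist x : 0 <= x -> `|nrm Omega v - nrm Omega (u x)| <= (m 0 x - l) * K.
  move=> x0; rewrite distrC; apply: le_trans (nrmB_le (u2 x x0) v2) _.
  have d0 : 0 <= m 0 x - l by have /andP[] := lm 0%N x x0; apply: le_trans.
  have d40 : 0 <= (m 0 x - l) * eta4 alpha beta (lam 0%N) by rewrite mulr_ge0.
  have md k : `|m k x - l| <= m 0 x - l.
    by have /andP[h1 h2] := lm k x x0; rewrite ger0_norm.
  have suv : L2series Omega phi (fun k => 1 * uk k x + (-1) * ul k) (fun y => u x y - v y).
    have := L2series_lin e2 1 (-1) (su x x0) sv.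
    by congr L2series; apply/funext => y; rewrite mul1r mulN1r.
  have [k|k|k|_ /(_ _ suv)] := L2series_split e2 eON d0 d40
    (c := fun k => 1 * uk k x + (-1) * ul k)
    (d1 := fun k => fk k * (m k x - l))
    (d2 := fun k => gk k * (1 / lam k * (m k x - l))) (c1 := fk) (c2 := gk) (k1 := f) (k2 := g)
    _ _ _ sf sg.
  - by rewrite /uk /ul; ring.
  - exact: le_mul.
  - rewrite (_ : gk k * _ = (m k x - l) * (gk k * (1 / lam k * 1))); last by ring.
    rewrite normrM -[leRHS]mulrA; apply: ler_pM => //.
    by apply: lamV; rewrite normr1.
  - by rewrite /K mulrDr mulrA.
exists (nrm Omega v).
have dK : (m 0 x - l) * K @[x --> +oo] --> (0 : R).
  by rewrite -(mul0r K); apply: cvgMl.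
have ucvg : nrm Omega (u x) @[x --> +oo] --> nrm Omega v.
  apply/cvgrPdist_le => eps eps0; have /cvgrPdist_le/(_ _ eps0) := dK.
  apply: filterS2 (nbhs_pinfty_ge (num_real (0 : R))) => x x0.
  rewrite sub0r normrN; apply: le_trans; apply: le_trans (udist x x0) _.
  exact: ler_norm.
have : (nrm Omega (u x))%:E @[x --> +oo] --> (nrm Omega v)%:E.
  by apply: cvg_EFin ucvg; exact: nearW.
apply: cvg_trans; apply: near_eq_cvg.
apply: filterS (nbhs_pinfty_ge (num_real (0 : R))) => x x0 /=.
by rewrite (L2norm_sqrt (u2 x x0)).
Qed.
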